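(* Let $V$ be a finite nonempty set, let $P=(P_{xy})_{x,y\in V}$ be a sub-Markovian transition matrix whose associated discrete-time Markov chain is transient, and let $\alpha>0$. Let $\mathcal{L}_\alpha$ be the associated unrooted oriented loop soup with intensity $\alpha$ and let $\theta=(\theta_x)_{x\in V}$ be its occupation time field on vertices. Then $\theta$ is a permanental random field with parameter $(\alpha^{-1},P)$; namely, for any $\mathbf{q}=(q_x)_{x\in V}\in\mathbb{N}^V$, $$\mathbb{P}(\theta=\mathbf{q})=\det(I-P)^\alpha\cdot\frac{\mathrm{per}_\alpha(P[\mathbf{q}])}{\prod_{x\in V}q_x!}.$$
   Context: $\mathbb{N}=\{0,1,2,\dots\}$. $\alpha$-permanent: for a $k\times k$ matrix $B$, $\mathrm{per}_\alpha(B)=\sum_{\pi\in S_k}\alpha^{\#(\pi)}\prod_{i=1}^k B_{i,\pi(i)}$, where $\#(\pi)$ is the number of disjoint cycles of the permutation $\pi$ (fixed points included). The $\alpha$-permanent of the $0\times0$ matrix is $1$. For $\mathbf{q}\in\mathbb{N}^V$, $P[\mathbf{q}]$ is the square matrix of order $\sum_x q_x$ obtained from $P$ by repeating the index $x$ (row and column) $q_x$ times: its rows and columns are indexed by pairs $(x,m)$, $x\in V$, $1\le m\le q_x$, and its $((x,m),(y,l))$ entry is $P_{xy}$. Sub-Markovian means $P_{xy}\ge 0$ and $\sum_{y}P_{xy}\le 1$ for all $x$. The associated Markov chain $(X_n)_{0\le n<\zeta}$ at $x$ jumps to $y$ with probability $P_{xy}$ and is killed with probability $1-\sum_yP_{xy}$.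 Transient means that the Green's function $G(x,y)=E^x\big(\sum_{n=0}^{\zeta-1}1_{\{X_n=y\}}\big)=\sum_{n\ge0}(P^n)_{xy}$ is finite for all $x,y\in V$. Loop soup: a rooted loop of length $n\ge 1$ is a sequence $(x_0,x_1,\dots,x_n)$ in $V$ with $x_n=x_0$ (each step along an edge $\{x,y\}$ with $P_{xy}\ne0$ or $P_{yx}\neq0$; one-step loops $(x,x)$ are allowed when $P_{xx}\neq0$). An unrooted loop is an equivalence class of rooted loops under cyclic shift (forgetting the starting point). The multiplicity $J(\gamma)$ of an unrooted loop $\gamma$ is the maximal integer $J$ such that $\gamma$ is the concatenation of $J$ identical loops. The loop measure $\mu$ on the (countable) set of unrooted loops is $\mu(\{\gamma\})=\frac{1}{J(\gamma)}\prod_{i=0}^{n-1}P_{x_ix_{i+1}}$ for $\gamma$ the class of $(x_0,\dots,x_n)$. The oriented loop soup $\mathcal{L}_\alpha$ with intensity $\alpha$ is a Poisson point process on the set of unrooted loops with intensity measure $\alpha\mu$ (i.e. the numbers of occurrences of distinct loops $\gamma$ are independent Poisson variables with means $\alpha\mu(\{\gamma\})$). Occupation time field on vertices: $\theta_x$ is the sum over all loops in $\mathcal{L}_\alpha$ (with repetition) of the number of visits to $x$, where the class of $(x_0,\dots,x_n)$ visits $x$ exactly $\#\{0\le i<n:x_i=x\}$ times. ''Permanental random field with parameter $(\alpha^{-1},P)$'' means precisely that the law of $\theta$ is given by the displayed formula. *)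

(* Defs.v *)
From HB Require Import structures.
From mathcomp Require Import all_boot all_order all_algebra perm.
From mathcomp Require Import generic_quotient.
From mathcomp Require Import all_classical all_reals all_analysis.
From mathcomp Require Import measurable_realfun.

Set Implicit Arguments.
Unset Strict Implicit.
Unset Printing Implicit Defensive.

Import Order.TTheory GRing.Theory Num.Theory.
Local Open Scope classical_set_scope.
Local Open Scope ring_scope.
Local Open Scope quotient_scope.

Section AlphaPermanent.
Variables (R : realType).

(* #|porbits s| is the number of cycles of s, fixed points included. *)
Definition alpha_per (alpha : R) (T : finType) (B : T -> T -> R) : R :=
  \sum_(s : {perm T}) alpha ^+ #|porbits s| * \prod_(i : T) B i (s i).

Definition repeat_mx (V : finType) (P : V -> V -> R) (q : V -> nat)
    (i j : {x : V & 'I_(q x)}) : R :=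
  P (tag i) (tag j).

End AlphaPermanent.

Section TransitionMatrix.
Variables (R : realType) (V : finType) (P : V -> V -> R).

Definition mx_of : 'M[R]_#|V| :=
  \matrix_(i < #|V|, j < #|V|) P (enum_val i) (enum_val j).

Definition sub_markovian : Prop :=
  (forall x y, 0 <= P x y) /\ (forall x, \sum_(y : V) P x y <= 1).

Definition green (x y : V) : \bar R :=
  (\sum_(0 <= n <oo) ((mx_of ^+ n) (enum_rank x) (enum_rank y))%:E)%E.

Definition transient : Prop := forall x y, (green x y < +oo)%E.

End TransitionMatrix.

Section Loops.
Variables (R : realType) (V : finType) (P : V -> V -> R).

Definition edge : rel V := [rel x y | (P x y != 0) || (P y x != 0)].

(* The rooted loop (x_0, ..., x_n), x_n = x_0, n >= 1, is encoded by the
   sequence [:: x_0; ...; x_(n-1)]; [cycle] includes the step from x_(n-1)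
   back to x_0. *)
Definition rooted_loop := {s : seq V | (s != [::]) && cycle edge s}.

Definition shift_rel : rel rooted_loop :=
  [rel s t : rooted_loop |
    [exists i : 'I_(size (val s)), val t == rot i (val s)]].

Lemma shift_relP (s t : rooted_loop) :
  reflect (exists n, val t = rot n (val s)) (shift_rel s t).
Proof.
apply: (iffP existsP) => [[i /eqP ->]|[n ->]]; first by exists i.
have s0 : (0 < size (val s))%N.
  by have := valP s; rewrite -size_eq0 lt0n => /andP[].
case: (ltnP n (size (val s))) => [ns|sn].
  by exists (Ordinal ns).
by exists (Ordinal s0); rewrite rot0 rot_oversize.
Qed.

Lemma shift_rel_refl : reflexive shift_rel.
Proof. by move=> s; apply/shift_relP; exists 0%N; rewrite rot0. Qed.

Lemma shift_rel_sym : symmetric shift_rel.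
Proof.
suff H s t : shift_rel s t -> shift_rel t s by move=> s t; apply/idP/idP => /H.
move=> /shift_relP[n e]; apply/shift_relP.
by exists (size (val t) - n)%N; rewrite e -/(rotr n _) rotK.
Qed.

Lemma shift_rel_trans : transitive shift_rel.
Proof.
move=> t s u /shift_relP[m e] /shift_relP[n f]; apply/shift_relP.
rewrite f e; case: (leqP m (size (val s))) => [ms|/ltnW sm]; last first.
  by rewrite (rot_oversize sm); exists n.
case: (leqP n (size (val s))) => [ns|/ltnW sn]; last first.
  by rewrite (@rot_oversize _ n) ?size_rot//; exists m.
by rewrite rot_add_mod //; eexists.
Qed.

Canonical shift_equiv :=
  EquivRel shift_rel shift_rel_refl shift_rel_sym shift_rel_trans.

Definition unrooted_loop := {eq_quot shift_equiv}.

Definition rooted_weight (s : seq V) : R :=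
  \prod_(p <- zip s (rot 1 s)) P p.1 p.2.

Lemma rooted_weight_rot n s : rooted_weight (rot n s) = rooted_weight s.
Proof.
rewrite /rooted_weight.
rewrite rot_rot; have sz : size s = size (rot 1 s) by rewrite size_rot.
have -> : zip (rot n s) (rot n (rot 1 s)) = rot n (zip s (rot 1 s)).
  rewrite -[RHS]zip_unzip /unzip1 /unzip2 !map_rot.
  by rewrite -/unzip1 -/unzip2 unzip1_zip ?unzip2_zip // sz.
by apply: perm_big; rewrite perm_rot.
Qed.

(* The maximal j such that the loop g, rooted at one of its points, is the
   concatenation of j copies of a loop; such a j is at most the length of g. *)
Definition multiplicity (g : unrooted_loop) : nat :=
  \max_(j < (size (val (repr g))).+1 |
      `[< exists s t : rooted_loop,
            \pi_unrooted_loop s = g /\ val s = flatten (nseq j (val t)) >]) j.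

Definition loop_measure (g : unrooted_loop) : R :=
  (multiplicity g)%:R^-1 * rooted_weight (val (repr g)).

Definition visits (g : unrooted_loop) (x : V) : nat :=
  count_mem x (val (repr g)).

(* [rooted_weight] and [visits] do not depend on the representative. *)
Lemma repr_shift (s : rooted_loop) :
  exists n, val (repr (\pi_unrooted_loop s)) = rot n (val s).
Proof.
by apply/shift_relP; rewrite -[shift_rel _ _]/(shift_equiv _ _) -eqmodE reprK.
Qed.

Lemma rooted_weight_pi (s : rooted_loop) :
  rooted_weight (val (repr (\pi_unrooted_loop s))) = rooted_weight (val s).
Proof. by have [n ->] := repr_shift s; exact: rooted_weight_rot. Qed.

Lemma visits_pi (s : rooted_loop) x :
  visits (\pi_unrooted_loop s) x = count_mem x (val s).
Proof.
by rewrite /visits; have [n ->] := repr_shift s; apply/seq.permP; rewrite perm_rot.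
Qed.

End Loops.

Section LoopSoup.
Context (d : measure_display) (Omega : measurableType d) (R : realType).
Variable Pr : probability Omega R.

Definition mutually_independent (I : choiceType)
    (X : I -> {RV Pr >-> nat}) : Prop :=
  forall (F : seq I) (A : I -> set nat), uniq F ->
    Pr (\bigcap_(i in [set` F]) X i @^-1` A i) =
    (\prod_(i <- F) Pr (X i @^-1` A i))%E.

(* A Poisson point process on the countable set of unrooted loops, given by
   the numbers N g of occurrences of each loop g.  The second argument of
   [poisson_prob] is unused; its value for rate 0 is the Dirac mass at 0. *)
Definition is_loop_soup (V : finType) (P : V -> V -> R) (alpha : R)
    (N : unrooted_loop P -> {RV Pr >-> nat}) : Prop :=
  mutually_independent N /\
  forall (g : unrooted_loop P) (A : set nat),
    distribution Pr (N g) A = poisson_prob (alpha * loop_measure g) 0 A.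

Definition occupation (V : finType) (P : V -> V -> R)
    (N : unrooted_loop P -> {RV Pr >-> nat}) (x : V) (w : Omega) : \bar R :=
  \esum_(g in [set: unrooted_loop P]) ((N g w * visits g x)%N%:R)%:E.

Lemma measurable_occupation (V : finType) (P : V -> V -> R)
    (N : unrooted_loop P -> {RV Pr >-> nat}) (x : V) :
  measurable_fun [set: Omega] (occupation N x).
Proof.
pose phi (g : unrooted_loop P) : nat := pickle (repr g).
have phi_inj : injective phi.
  by move=> g h /(pcan_inj pickleK) gh; rewrite -(reprK g) gh reprK.
pose psi (n : nat) : option (unrooted_loop P) :=
  obind (fun s => let g := \pi_(unrooted_loop P) s in
    if phi g == n then Some g else None) (unpickle n).
pose f (g : unrooted_loop P) w : \bar R := ((N g w * visits g x)%N%:R)%:E.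
pose b n w : \bar R := if psi n is Some g then f g w else 0%E.
have psiK g : psi (phi g) = Some g.
  by rewrite /psi /phi pickleK /= reprK eqxx.
have psi_phi n g : psi n = Some g -> phi g = n.
  by rewrite /psi; case: unpickle => //= s; case: eqP => // <- [<-].
have f0 g w : (0 <= f g w)%E by rewrite lee_fin.
have b0 n w : (0 <= b n w)%E by rewrite /b; case: (psi n).
rewrite (_ : occupation N x = fun w => (\sum_(0 <= n <oo) b n w)%E); last first.
  apply/funext => w; rewrite nneseries_esumT//.
  have -> : \esum_(n in [set: nat]) b n w = \esum_(n in range phi) b n w.
    rewrite [RHS]esum_mkcond; apply: eq_esum => n _.
    case: ifPn => // /negP nphi; rewrite /b; case e: (psi n) => [g|//].
    by case: nphi; rewrite inE; exists g => //; exact: psi_phi.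
  rewrite (@reindex_esum _ _ _ setT _ phi) //; last first.
    by apply: inj_bij => g h _ _ /phi_inj.
  by apply: eq_esum => g _; rewrite /b psiK.
apply: ge0_emeasurable_sum => // n _; rewrite /b.
case: (psi n) => [g|]; last exact: measurable_cst.
apply/measurable_EFinP.
rewrite [X in measurable_fun _ X](_ : _ =
  (fun k : nat => (k * visits g x)%:R : R) \o N g)//.
exact: measurableT_comp.
Qed.

End LoopSoup.

(* Main.v *)
Require Import Defs.
From HB Require Import structures.
From mathcomp Require Import all_boot all_order all_algebra perm.
From mathcomp Require Import generic_quotient.
From mathcomp Require Import all_classical all_reals all_analysis.
From mathcomp Require Import ring zify.

(** Write v(g) for the vector of visits of the loop g and |q| for the sum of
    the q_x.  Only loops of length at most |q| can be present when theta = q,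
    and for n >= |q| the loops of length at most n form a finite family of
    independent Poisson variables.  Hence the vector of their total visits
    equals q with probability exp(- alpha M_n) a_n(q), where M_n is the loop
    measure of the loops of length at most n and
      a_n(q) = sum over (c_g) with sum_g c_g v(g) = q of
               prod_g (alpha mu(g))^(c_g) / c_g!
    ([prob_partial_occupation]).  The events decrease to {theta = q} as n grows
    ([occupation_eventE]), so two facts remain.

    Combinatorics: a_n(q) = per_alpha(P[q]) / prod_x q_x! for n >= |q|.  Both
    sides are 1 at q = 0 and satisfy the same recursion
      q_x f(q) = alpha * sum over rooted loops s at x of w(s) f(q - v(s))
    ([loop_recursion]), which determines f ([loop_recursion_unique]).
    - For a_n it is the identity x d/dx exp(S) = exp(S) * (x d/dx S) read
      coefficientwise ([poisson_coef_rec]), once sums over unrooted loops are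
      turned into sums over rooted ones.  A loop of length k and multiplicity J
      has k/J distinct rootings, and this is what the factor 1/J of the loop
      measure accounts for ([sum_loop_measure]).
    - For the permanent it is the expansion along the cycle through one of the
      copies of x.  The cycle is followed one step at a time: if the
      distinguished index 0 is sent to k <> 0, deleting 0 from its cycle leaves
      a permutation of the other indices with as many cycles, and the matrix
      has lost row 0 while column k has become column 0
      ([alpha_per_ord_recl]).  The remaining piece is again a permanent with a
      distinguished index whose row and column carry different labels
      ([per_walk_step]), and unrolling gives all walks back to x.

    Normalization: exp(- alpha M_n) tends to det(I - P)^alpha.  By the same
    counting of rootings M_n = sum over 1 <= k <= n of tr(P^k)/k
    ([sum_loop_measure_mass]).  With f(t) = det(I - tP) and S_n(t) the sum of
    t^k tr(P^k)/k over 1 <= k <= n, Jacobi's formula gives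
      f' + f S_n' = - t^n tr(adj(I - tP) P^(n+1)),
    so the derivative of f exp(S_n) on [0, 1] is of the order of the entries
    of P^(n+1), which tend to 0 by transience.  As f exp(S_n) is 1 at t = 0,
    it tends to 1 at t = 1 ([det_exp_cvg]). *)

Set Implicit Arguments.
Unset Strict Implicit.
Unset Printing Implicit Defensive.
Import Order.TTheory GRing.Theory Num.Theory.
Local Open Scope ring_scope.

(** * One-step expansion of the alpha-permanent *)

(** An injection commuting with two permutations carries cycles to cycles.
    It serves both for relabelling the index type and for adding a fixed
    point. *)
Lemma porbit_intertwine (T1 T2 : finType) (h : T1 -> T2)
    (s1 : {perm T1}) (s2 : {perm T2}) :
  injective h -> (forall x, s2 (h x) = h (s1 x)) ->
  forall x, porbit s2 (h x) = h @: porbit s1 x.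
Proof.
move=> hI hs x.
have hX i y : (s2 ^+ i)%g (h y) = h ((s1 ^+ i)%g y).
  by elim: i => [|i IH]; rewrite ?expg0 ?perm1// !expgSr !permM IH hs.
apply/setP => y; apply/porbitP/imsetP => [[i ->]|[z /porbitP[i ->] ->]].
  by exists ((s1 ^+ i)%g x); rewrite ?mem_porbit// hX.
by exists i; rewrite hX.
Qed.

Lemma card_porbits_lift0 n (s : {perm 'I_n}) :
  #|porbits (lift_perm ord0 ord0 s)| = #|porbits s|.+1.
Proof.
set t := lift_perm ord0 ord0 s.
have lI : injective (lift (@ord0 n)) by exact: lift_inj.
have tl i : t (lift ord0 i) = lift ord0 (s i) by rewrite lift_perm_lift.
have t0 : porbit t ord0 = [set ord0].
  apply/setP => y; rewrite inE; apply/porbitP/eqP => [[i ->]|->].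
    by elim: i => [|i IH]; rewrite ?expg0 ?perm1// expgSr permM IH lift_perm_id.
  by exists 0%N; rewrite expg0 perm1.
have -> : porbits t =
    ([set ord0] |: [set (lift ord0 @: (X : {set 'I_n})) | X in porbits s])%SET.
  apply/setP => X; rewrite !inE; apply/imsetP/orP.
    move=> [x _ ->]; case: (unliftP ord0 x) => [j ->|->]; last first.
      by left; rewrite t0.
    right; rewrite (porbit_intertwine lI tl); apply: imset_f.
    exact: imset_f.
  move=> [/eqP ->|/imsetP[Y /imsetP[y _ ->] ->]].
    by exists ord0.
  by exists (lift ord0 y); rewrite ?(porbit_intertwine lI tl).
rewrite cardsU1 card_imset; last exact: imset_inj.
suff -> : ([set ord0] \notin [set (lift ord0 @: (X : {set 'I_n})) | X in porbits s])%SET.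
  by [].
apply/negP => /imsetP[X _ /setP/(_ ord0)]; rewrite inE eqxx => /esym/imsetP[y _ h].
by have := neq_lift ord0 y; rewrite -h eqxx.
Qed.

Lemma alpha_per_reindex (R : realType) (a : R) (T1 T2 : finType) (h : T1 -> T2)
    (B : T2 -> T2 -> R) : bijective h ->
  alpha_per a B = alpha_per a (fun i j => B (h i) (h j)).
Proof.
move=> hB; have [g hK gK] := hB; rewrite /alpha_per.
have conjI (s : {perm T1}) : injective (fun y => h (s (g y))).
  by apply: inj_comp; [exact: bij_inj|apply: inj_comp; [exact: perm_inj|exact: can_inj gK]].
have conjI' (s : {perm T2}) : injective (fun x => g (s (h x))).
  by apply: inj_comp; [exact: can_inj gK|apply: inj_comp; [exact: perm_inj|exact: bij_inj]].
rewrite (reindex (fun s : {perm T1} => perm (conjI s))) /=; last first.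
  exists (fun s => perm (conjI' s)) => s _; apply/permP => x.
    by rewrite !(permE, hK).
  by rewrite !(permE, gK).
apply: eq_bigr => s _; congr (_ ^+ _ * _); last first.
  by rewrite (reindex h) /=; [apply: eq_bigr => i _; rewrite permE hK|exact: onW_bij].
have ht x : perm (conjI s) (h x) = h (s x) by rewrite permE hK.
have -> : porbits (perm (conjI s)) =
    ([set (h @: (X : {set T1})) | X in porbits s])%SET.
  apply/setP => X; apply/imsetP/imsetP => [[x _ ->]|[Y /imsetP[y _ ->] ->]].
    exists (porbit s (g x)); first exact: imset_f.
    by rewrite -(porbit_intertwine (bij_inj hB) ht) gK.
  by exists (h y); rewrite ?(porbit_intertwine (bij_inj hB) ht).
by rewrite card_imset //; exact/imset_inj/bij_inj.
Qed.

(** Every permutation of n + 1 points is uniquely [lift0 s] followed by the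
    transposition of 0 and k, where k is the image of 0.  For k = 0 the point
    0 is a cycle of its own, hence the factor alpha.  For k <> 0 the
    transposition merges the cycle {0} into the cycle of k, so the number of
    cycles is that of s, and the index that s sends to k is now sent to 0. *)
Lemma alpha_per_ord_recl (R : realType) (a : R) n (B : 'I_n.+1 -> 'I_n.+1 -> R) :
  alpha_per a B =
    a * B ord0 ord0 * alpha_per a (fun i j => B (lift ord0 i) (lift ord0 j)) +
    \sum_(k < n) B ord0 (lift ord0 k) *
      alpha_per a (fun i j => B (lift ord0 i)
                                (if j == k then ord0 else lift ord0 j)).
Proof.
rewrite /alpha_per.
(* p.1 is the image of 0. *)
pose F (p : 'I_n.+1 * {perm 'I_n}) : {perm 'I_n.+1} :=
  (lift_perm ord0 ord0 p.2 * tperm ord0 p.1)%g.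
have F0 p : F p ord0 = p.1 by rewrite permM lift_perm_id tpermL.
have FI : injective F.
  move=> p q pq; have e1 : p.1 = q.1 by rewrite -!F0 pq.
  have : lift_perm ord0 ord0 p.2 = lift_perm ord0 ord0 q.2.
    by apply: (@mulIg _ (tperm ord0 p.1)); rewrite -/(F p) pq /F e1.
  move=> /permP e2; rewrite (surjective_pairing p) (surjective_pairing q) e1.
  congr (_, _); apply/permP => i; apply: (@lift_inj _ ord0).
  by have := e2 (lift ord0 i); rewrite !lift_perm_lift.
have FB : bijective F.
  apply: inj_card_bij => //.
  by rewrite card_prod card_ord !card_Sn factS.
rewrite (reindex F) /=; last exact: onW_bij.
rewrite -(pair_bigA _ (fun k s => a ^+ #|porbits (F (k, s))| *
   \prod_i B i (F (k, s) i))) /= big_ord_recl /=; congr (_ + _).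
  rewrite big_distrr /=; apply: eq_bigr => s _.
  have -> : F (ord0, s) = lift_perm ord0 ord0 s by rewrite /F tperm1 mulg1.
  rewrite card_porbits_lift0 exprS big_ord_recl lift_perm_id.
  rewrite mulrACA; congr (_ * (_ * _)); apply: eq_bigr => i _.
  by rewrite (lift_perm_lift _ _ s).
apply: eq_bigr => k _; rewrite big_distrr /=; apply: eq_bigr => s _.
rewrite big_ord_recl F0 mulrCA; congr (_ * (_ ^+ _ * _)).
  (* The counting lemma multiplies by a transposition on the other side, hence
     the passage to inverses, which have the same cycles. *)
  have := porbits_mul_tperm (lift_perm ord0 ord0 s)^-1%g ord0 (lift ord0 k).
  rewrite -porbitsV /= porbitsV.
  have -> : (tperm ord0 (lift ord0 k) * (lift_perm ord0 ord0 s)^-1 =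
     (F (lift ord0 k, s))^-1)%g by rewrite /F fingroup.invMg tpermV.
  rewrite !porbitsV card_porbits_lift0 lift_permV.
  have -> : ord0 \in porbit (lift_perm ord0 ord0 s^-1) (lift ord0 k) = false.
    apply/negP; rewrite (porbit_intertwine (@lift_inj _ ord0)
      (fun i => lift_perm_lift ord0 ord0 s^-1%g i)).
    by move=> /imsetP[y _ h]; have := neq_lift ord0 y; rewrite -h eqxx.
  have -> : (ord0 != lift ord0 k) = true by exact: neq_lift.
  by move=> /= h; apply/eqP; move: h; rewrite doubleS double0 addn1 addn2 => -[->].
apply: eq_bigr => i _; rewrite permM (lift_perm_lift _ _ s).
case: eqP => [->|/eqP sk]; first by rewrite tpermR.
by rewrite tpermD ?neq_lift // (inj_eq (@lift_inj _ _)) eq_sym.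
Qed.

(** * The alpha-permanent as a function of a multiset of labels *)

Section PermanentRecursion.
Variables (R : realType) (V : finType) (P : V -> V -> R) (alpha : R).

(** The i-th index carries a row label and a column label.  Distinct labels are
    needed because the one-step expansion produces an index whose row and
    column come from different vertices. *)
Definition per_tuple n (t : n.-tuple (V * V)) : R :=
  alpha_per alpha (fun i j : 'I_n => P (tnth t i).1 (tnth t j).2).

Definition per_seq (l : seq (V * V)) : R := per_tuple (in_tuple l).

Lemma per_seq_tuple n (t : n.-tuple (V * V)) : per_seq t = per_tuple t.
Proof.
case: t => s i; have e := eqP i; subst n.
by rewrite /per_seq; congr (per_tuple _); apply: val_inj.
Qed.

Lemma per_seq_perm l1 l2 : perm_eq l1 l2 -> per_seq l1 = per_seq l2.
Proof.
move=> /(@tuple_permP _ _ l1 (in_tuple l2))[p ->].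
rewrite (per_seq_tuple [tuple tnth (in_tuple l2) (p i) | i < size l2]).
rewrite /per_seq /per_tuple [RHS](alpha_per_reindex _ _ (h := p)); last first.
  exact/injF_bij/perm_inj.
by apply: eq_bigr => s _; congr (_ * _); apply: eq_bigr => i _; rewrite !tnth_mktuple.
Qed.

Lemma alpha_per_labels (T : finType) (l : T -> V * V) :
  alpha_per alpha (fun i j : T => P (l i).1 (l j).2) = per_seq (map l (enum T)).
Proof.
rewrite (alpha_per_reindex _ _ (h := @enum_val T predT)); last first.
  exact: enum_val_bij.
transitivity (per_tuple [tuple l (enum_val i) | i < #|T|]).
  by apply: eq_bigr => s _; congr (_ * _); apply: eq_bigr => i _; rewrite !tnth_mktuple.
rewrite -per_seq_tuple; apply: per_seq_perm => /=.
rewrite (map_comp l enum_val); apply/perm_map/uniq_perm.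
- by rewrite map_inj_uniq ?enum_uniq//; exact: enum_val_inj.
- exact: enum_uniq.
move=> x; rewrite mem_enum; apply/mapP; exists (enum_rank x) => //.
  by rewrite mem_enum.
by rewrite enum_rankK.
Qed.

Lemma per_seq0 : per_seq [::] = 1.
Proof.
rewrite /per_seq /per_tuple /alpha_per (bigD1 (1%g : {perm 'I_0}))//= big_ord0 mulr1.
rewrite big1 => [|s /eqP[]]; last by apply/permP => -[].
rewrite addr0 (_ : #|_| = 0%N)// ; apply/eqP; rewrite cards_eq0.
by apply/eqP/setP => X; rewrite inE; apply/imsetP => -[[]].
Qed.

Lemma sum_seq_count (s : seq V) (F : V -> R) :
  \sum_(y <- s) F y = \sum_y (count_mem y s)%:R * F y.
Proof.
elim: s => [|x s IH]; first by rewrite big_nil big1// => y _; rewrite mul0r.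
rewrite big_cons IH (bigD1 x)//= [in RHS](bigD1 x)//= eqxx natrD mulrDl mul1r addrA.
congr (_ + _); apply: eq_bigr => y yx.
by rewrite [_ == _]eq_sym (negbTE yx).
Qed.

Definition diag (x : V) := (x, x).

(** Sending the distinguished index, with row z and column x, to an index of
    label y leaves an index with row y and column x: the walk from z back to x
    has moved to y. *)
Lemma per_seq_step z x (s : seq V) :
  per_seq ((z, x) :: map diag s) =
    alpha * P z x * per_seq (map diag s) +
    \sum_y (count_mem y s)%:R * (P z y * per_seq ((y, x) :: map diag (rem y s))).
Proof.
have -> : per_seq ((z, x) :: map diag s) =
    per_tuple (cons_tuple (z, x) (map_tuple diag (in_tuple s))).
  by rewrite -per_seq_tuple.
rewrite {1}/per_tuple [LHS]alpha_per_ord_recl.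
have tl k : tnth (cons_tuple (z, x) (map_tuple diag (in_tuple s))) (lift ord0 k) =
            diag (tnth (in_tuple s) k).
  by rewrite tnthS tnth_map.
have t0 : tnth (cons_tuple (z, x) (map_tuple diag (in_tuple s))) ord0 = (z, x).
  by rewrite tnth0.
rewrite -sum_seq_count [in RHS]big_tnth t0; congr (_ + _).
  have -> : per_seq (map diag s) = per_tuple (map_tuple diag (in_tuple s)).
    by rewrite -per_seq_tuple.
  congr (_ * _); apply: eq_bigr => p _; congr (_ * _).
  by apply: eq_bigr => i _; rewrite !tl !tnth_map.
apply: eq_bigr => k _; rewrite tl /=; congr (_ * _).
set y := tnth _ k.
pose u := [tuple if i == k then (y, x) else diag (tnth (in_tuple s) i) | i < size s].
transitivity (per_tuple u).
  apply: eq_bigr => p _; congr (_ * _); apply: eq_bigr => i _.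
  rewrite tl !tnth_mktuple; congr (P _ _).
    by case: eqP => // ->.
  by case: eqP => _; rewrite ?t0 ?tl.
rewrite -per_seq_tuple; apply: per_seq_perm.
have sy : perm_eq (map diag s) (diag y :: map diag (rem y s)).
  by rewrite -map_cons; apply/perm_map/perm_to_rem/mem_tnth.
have cu f : count f (map diag s) = (\sum_(i < size s) f (diag (tnth (in_tuple s) i)))%N.
  by rewrite -sum1_count big_map big_mkcond big_tnth.
apply/seq.permP => f /=; have := seq.permP sy f; rewrite /= cu (bigD1 k)//= => /addnI <-.
rewrite -sum1_count big_map big_mkcond /= big_enum /= (bigD1 k)//= eqxx; congr (_ + _)%N.
by apply: eq_bigr => i /negbTE ->.
Qed.

Definition cnt (s : seq V) (x : V) : nat := count_mem x s.

Definition qsub (q c : V -> nat) : V -> nat := fun x => (q x - c x)%N.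

Definition repeat_seq (q : V -> nat) : seq V :=
  flatten [seq nseq (q x) x | x <- enum V].

Lemma cnt_repeat_seq q : cnt (repeat_seq q) = q.
Proof.
apply/funext => y; rewrite /cnt /repeat_seq count_flatten -map_comp sumnE big_map big_enum /=.
rewrite (bigD1 y)//= count_nseq /= eqxx mul1n big1 ?addn0// => x xy.
by rewrite count_nseq /= (negbTE xy) mul0n.
Qed.

Lemma perm_cnt (s t : seq V) : cnt s = cnt t -> perm_eq s t.
Proof. by move=> st; apply/allP => x _ /=; apply/eqP; exact: (congr1 (@^~ x) st). Qed.

Definition facts (q : V -> nat) : nat := (\prod_x (q x)`!)%N.

Definition per_coef (q : V -> nat) : R := per_seq (map diag (repeat_seq q)) / (facts q)%:R.

(** Normalized permanent of P[q] bordered by one index with row z and column x;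
    its expansion enumerates the walks from z to x. *)
Definition per_walk (q : V -> nat) (z x : V) : R :=
  per_seq ((z, x) :: map diag (repeat_seq q)) / (facts q)%:R.

Lemma alpha_per_repeat q :
  alpha_per alpha (repeat_mx P (q := q)) / (\prod_(x : V) (q x)`!)%N%:R = per_coef q.
Proof.
congr (_ / _); transitivity (per_seq
    (map (fun i : {x & 'I_(q x)} => diag (tag i)) (enum {: {x & 'I_(q x)}}))).
  by rewrite -alpha_per_labels.
apply: per_seq_perm; rewrite (map_comp diag); apply/perm_map/perm_cnt.
rewrite cnt_repeat_seq; apply/funext => y.
rewrite /cnt count_map -sum1_count big_mkcond big_enum /=.
have := sig_big_dep (R := nat) (op := addn) (I := V) (J := fun x => 'I_(q x))
  xpredT (fun _ => xpredT) (fun x _ => (x == y) : nat).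
move=> /= <-.
rewrite (bigD1 y)//= eqxx sum1_card card_ord big1 ?addn0// => x /negbTE ->.
by rewrite big1.
Qed.

Lemma facts_neq0 q : (facts q)%:R != 0 :> R.
Proof.
by rewrite pnatr_eq0 -lt0n; apply/prodn_gt0 => x; rewrite fact_gt0.
Qed.

Lemma facts_qsub1 q y : (0 < q y)%N -> facts q = (q y * facts (qsub q (cnt [:: y])))%N.
Proof.
move=> qy; rewrite /facts (bigD1 y)//= [in RHS](bigD1 y)//= mulnA.
rewrite /qsub /cnt /= eqxx addn0 subn1 -[in LHS](prednK qy) factS prednK//.
congr (_ * _)%N; apply: eq_bigr => x xy.
by rewrite eq_sym (negbTE xy) subn0.
Qed.

(** Distinguish one of the q_x copies of x. *)
Lemma per_coef_step q x : (0 < q x)%N ->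
  (q x)%:R * per_coef q = per_walk (qsub q (cnt [:: x])) x x.
Proof.
move=> qx; rewrite /per_coef /per_walk (facts_qsub1 qx) natrM.
have -> : per_seq (map diag (repeat_seq q)) =
          per_seq ((x, x) :: map diag (repeat_seq (qsub q (cnt [:: x])))).
  apply: per_seq_perm; rewrite -/(diag x) -map_cons; apply/perm_map/perm_cnt.
  apply/funext => y; rewrite cnt_repeat_seq.
  rewrite -[RHS]/((x == y) + cnt (repeat_seq (qsub q (cnt [:: x]))) y)%N.
  rewrite cnt_repeat_seq /qsub /cnt /=.
  by case: (eqVneq x y) => [<-|_]; [rewrite addn0 subnKC|rewrite subn0].
have := facts_neq0 (qsub q (cnt [:: x])).
have : (q x)%:R != 0 :> R by rewrite pnatr_eq0 -lt0n.
by move=> h1 h2; field; rewrite h1 h2.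
Qed.

(** The multiplicity q_y of the possible next labels y turns 1 / q! into the
    normalization 1 / (q - 1_y)! of the next term. *)
Lemma per_walk_step q z x :
  per_walk q z x = alpha * P z x * per_coef q +
    \sum_(y | (0 < q y)%N) P z y * per_walk (qsub q (cnt [:: y])) y x.
Proof.
rewrite /per_walk per_seq_step mulrDl -mulrA; congr (_ + _).
rewrite mulr_suml [in RHS]big_mkcond; apply: eq_bigr => y _.
rewrite -/(cnt _ y) cnt_repeat_seq; case: ifPn => [qy|]; last first.
  by rewrite -eqn0Ngt => /eqP ->; rewrite mul0r mul0r.
rewrite (facts_qsub1 qy) natrM.
have -> : per_seq ((y, x) :: map diag (rem y (repeat_seq q))) =
          per_seq ((y, x) :: map diag (repeat_seq (qsub q (cnt [:: y])))).
  apply: per_seq_perm; rewrite perm_cons; apply/perm_map/perm_cnt.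
  rewrite cnt_repeat_seq; apply/funext => w; rewrite /qsub -[q in RHS]cnt_repeat_seq /cnt.
  have /seq.permP/(_ (pred1 w)) /= -> : perm_eq (repeat_seq q) (y :: rem y (repeat_seq q)).
    by apply: perm_to_rem; rewrite -has_pred1 has_count -/(cnt _ y) cnt_repeat_seq.
  by rewrite addn0 addKn.
have := facts_neq0 (qsub q (cnt [:: y])).
have : (q y)%:R != 0 :> R by rewrite pnatr_eq0 -lt0n.
by move=> h1 h2; field; rewrite h1 h2.
Qed.

End PermanentRecursion.

(** * The loop recursion and its uniqueness *)

Lemma sum_tupleS (R : nmodType) (V : finType) k (A : pred (seq V)) (F : seq V -> R) :
  \sum_(t : k.+1.-tuple V | A t) F t =
  \sum_y \sum_(t : k.-tuple V | A (y :: t)) F (y :: t).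
Proof.
rewrite pair_big_dep /= (reindex (fun p : V * k.-tuple V => cons_tuple p.1 p.2)) //=.
exists (fun t : k.+1.-tuple V => (thead t, behead_tuple t)) => [[y t] _|t _] /=.
  by rewrite theadE; congr (_, _); apply: val_inj.
by rewrite [RHS]tuple_eta; apply: val_inj.
Qed.

Lemma sum_tuple0 (R : nmodType) (V : finType) (A : pred (seq V)) (F : seq V -> R) :
  \sum_(t : 0.-tuple V | A t) F t = if A [::] then F [::] else 0.
Proof.
rewrite big_mkcond (bigD1 [tuple])//= big1 ?addr0// => t.
by rewrite [t](_ : t = [tuple]) ?eqxx//; exact: tuple0.
Qed.

Section LoopRecursion.
Variables (R : realType) (V : finType) (P : V -> V -> R) (alpha : R).

Definition walk_weight z (s : seq V) x : R :=
  \prod_(p <- zip (z :: s) (rcons s x)) P p.1 p.2.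

Lemma walk_weight_nil z x : walk_weight z [::] x = P z x.
Proof. by rewrite /walk_weight /= big_seq1. Qed.

Lemma walk_weight_cons z y s x : walk_weight z (y :: s) x = P z y * walk_weight y s x.
Proof. by rewrite /walk_weight /= big_cons. Qed.

Lemma rooted_weight_walk x s : rooted_weight P (x :: s) = walk_weight x s x.
Proof. by rewrite /rooted_weight rot1_cons. Qed.

Definition leqf (c q : V -> nat) := [forall x, c x <= q x]%N.

Definition mass (q : V -> nat) : nat := (\sum_x q x)%N.

Lemma mass_cnt (s : seq V) : mass (cnt s) = size s.
Proof.
rewrite /mass /cnt; elim: s => [|x s IH] /=; first by rewrite big1.
by rewrite big_split /= IH (bigD1 x)//= eqxx big1 ?addn0// => y; rewrite eq_sym => /negbTE ->.
Qed.

Lemma cnt_cons (y : V) s x : cnt (y :: s) x = ((y == x) + cnt s x)%N.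
Proof. by []. Qed.

Lemma leqf_cons y s q :
  leqf (cnt (y :: s)) q = (0 < q y)%N && leqf (cnt s) (qsub q (cnt [:: y])).
Proof.
apply/forallP/andP => [h|[qy /forallP h] x].
  split; first by have := h y; rewrite cnt_cons eqxx; case: (q y).
  apply/forallP => x; have := h x; rewrite /qsub !cnt_cons /= => hx.
  by rewrite leq_subRL ?addn0//; apply: leq_trans hx; rewrite leq_addr.
have := h x; rewrite /qsub !cnt_cons /= addn0 => hx.
rewrite -leq_subRL// ; case: eqP => [<-|_] //; exact: qy.
Qed.

Lemma qsub_cons q (y : V) s : qsub q (cnt (y :: s)) = qsub (qsub q (cnt [:: y])) (cnt s).
Proof. by apply/funext => x; rewrite /qsub !cnt_cons /= addn0 subnDA. Qed.

Lemma mass_qsub q c : leqf c q -> mass q = (mass c + mass (qsub q c))%N.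
Proof.
move=> /forallP cq; rewrite /mass -big_split /=; apply: eq_bigr => x _.
by rewrite /qsub subnKC.
Qed.

(** The intermediate vertices of a walk from z to x use up part of q, and f is
    evaluated at what remains. *)
Definition walk_sum m (f : (V -> nat) -> R) q z x : R :=
  alpha * \sum_(k < m) \sum_(s : k.-tuple V | leqf (cnt s) q)
    walk_weight z s x * f (qsub q (cnt s)).

Lemma leqf_cnt0 q : leqf (cnt [::]) q.
Proof. by apply/forallP => x. Qed.

Lemma qsub_cnt0 (q : V -> nat) : qsub q (cnt [::]) = q.
Proof. by apply/funext => x; rewrite /qsub subn0. Qed.

Lemma leqf_cnt1 q y : leqf (cnt [:: y]) q = (0 < q y)%N.
Proof. by rewrite leqf_cons leqf_cnt0 andbT. Qed.

Lemma walk_sumS m f q z x :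
  walk_sum m.+1 f q z x = alpha * P z x * f q +
    \sum_(y | (0 < q y)%N) P z y * walk_sum m f (qsub q (cnt [:: y])) y x.
Proof.
rewrite /walk_sum big_ord_recl mulrDr; congr (_ + _).
  rewrite (sum_tuple0 (fun s => leqf (cnt s) q)
    (fun s => walk_weight z s x * f (qsub q (cnt s)))) leqf_cnt0.
  by rewrite walk_weight_nil qsub_cnt0 mulrA.
rewrite [LHS]mulr_sumr.
under [RHS]eq_bigr => y _ do rewrite mulrCA mulr_sumr mulr_sumr.
rewrite [RHS]exchange_big /=; apply: eq_bigr => k _.
rewrite (sum_tupleS _ (fun s => leqf (cnt s) q)
    (fun s => walk_weight z s x * f (qsub q (cnt s)))) mulr_sumr [RHS]big_mkcond /=.
apply: eq_bigr => y _; case: ifPn => [qy|nqy]; last first.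
  by rewrite big1 ?mulr0// => t; rewrite leqf_cons (negbTE nqy).
congr (_ * _); rewrite mulr_sumr; apply: eq_big => t.
  by rewrite leqf_cons qy.
by move=> _; rewrite walk_weight_cons qsub_cons mulrA.
Qed.

(** Each step of the walk uses up one index, so after |q| steps no copy is left
    and a bound m > |q| on the length loses nothing. *)
Lemma per_walkE m q z x : (mass q < m)%N ->
  per_walk P alpha q z x = walk_sum m (per_coef P alpha) q z x.
Proof.
elim: m q z x => // m IH q z x qm; rewrite per_walk_step walk_sumS; congr (_ + _).
apply: eq_bigr => y qy; rewrite IH//.
by move: qm; rewrite (@mass_qsub q (cnt [:: y])) ?leqf_cnt1// mass_cnt.
Qed.

(** The rooted loop x :: s has at most m points; when |q| <= m this is no
    restriction, and it keeps the sum finite. *)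
Definition loop_recursion m (f : (V -> nat) -> R) : Prop :=
  forall q x, (mass q <= m)%N ->
  (q x)%:R * f q = alpha * \sum_(k < m) \sum_(s : k.-tuple V | leqf (cnt (x :: s)) q)
    rooted_weight P (x :: s) * f (qsub q (cnt (x :: s))).

Lemma per_coef_recursion m : loop_recursion m (per_coef P alpha).
Proof.
move=> q x qm; have [q0|qx] := posnP (q x).
  rewrite q0 mul0r big1 ?mulr0// => k _; rewrite big1// => s.
  by rewrite leqf_cons q0.
rewrite per_coef_step// (@per_walkE m); last first.
  by apply: leq_trans qm; rewrite (@mass_qsub q (cnt [:: x])) ?leqf_cnt1// mass_cnt.
rewrite /walk_sum; congr (_ * _); apply: eq_bigr => k _; apply: eq_big => s.
  by rewrite leqf_cons qx.
by move=> _; rewrite rooted_weight_walk [in RHS]qsub_cons.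
Qed.

(** At q <> 0 some q_x is nonzero, and the loops on the right contain at least
    the point x, so f(q) is determined by values at smaller vectors. *)
Lemma loop_recursion_unique m f g : loop_recursion m f -> loop_recursion m g ->
  f (fun=> 0%N) = g (fun=> 0%N) -> forall q, (mass q <= m)%N -> f q = g q.
Proof.
move=> hf hg fg0 q; have [n] := ubnP (mass q); elim: n q => // n IH q qn qm.
have [[x qx]|/forallNP q0] := pselect (exists x, (0 < q x)%N); last first.
  have -> // : q = fun=> 0%N.
  by apply/funext => x; have := q0 x; case: (q x) => // k [].
apply: (@mulfI _ (q x)%:R); first by rewrite pnatr_eq0 -lt0n.
rewrite hf// hg//; congr (_ * _); apply: eq_bigr => k _; apply: eq_bigr => s sq.
have e := mass_qsub sq; rewrite mass_cnt /= in e.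
by congr (_ * _); apply: IH; lia.
Qed.

Lemma per_coef0 : per_coef P alpha (fun=> 0%N) = 1.
Proof.
rewrite /per_coef /facts big1 ?divr1// (_ : repeat_seq _ = [::]) ?per_seq0//.
by apply/size0nil; rewrite -mass_cnt cnt_repeat_seq /mass big1.
Qed.

End LoopRecursion.

(** * The logarithmic derivative of det(I - XA) *)

Lemma deriv_prod (R : comNzRingType) (I : finType) (F : I -> {poly R}) :
  (\prod_i F i)^`() = \sum_i (F i)^`() * \prod_(j | j != i) F j.
Proof.
suff H (r : seq I) : uniq r -> (\prod_(i <- r) F i)^`() =
    \sum_(i <- r) (F i)^`() * \prod_(j <- r | j != i) F j.
  exact: H (index_enum_uniq I).
elim: r => [_|x r IH /= /andP[xr ur]]; first by rewrite !big_nil derivC.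
have rx : \prod_(j <- r | j != x) F j = \prod_(j <- r) F j.
  rewrite -big_filter; congr (\big[_/_]_(_ <- _) _).
  by apply/all_filterP/allP => y yr; apply: contraNneq xr => <-.
rewrite !big_cons derivM IH// eqxx /= rx.
congr (_ + _); rewrite mulr_sumr; apply: eq_big_seq => i ir.
rewrite big_cons ifT; first by rewrite mulrCA.
by apply: contraNneq xr => ->.
Qed.

(** Jacobi's formula: the derivative of the Leibniz expansion is the sum over j
    of the determinants with row j differentiated, and the expansion of each
    along row j involves only cofactors of A. *)
Lemma deriv_det (R : comNzRingType) n (A : 'M[{poly R}]_n) :
  (\det A)^`() = \tr (\adj A *m map_mx (@deriv R) A).
Proof.
(* A with row j differentiated *)
pose Aj (j : 'I_n) := \matrix_(k, l) (if k == j then (A k l)^`() else A k l).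
transitivity (\sum_j \det (Aj j)).
  rewrite /determinant raddf_sum /= exchange_big /=; apply: eq_bigr => s _.
  have sgnD p : ((-1) ^+ s * p)^`() = (-1) ^+ s * p^`() :> {poly R}.
    by rewrite !mulr_sign; case: (s : bool); rewrite ?derivN.
  rewrite sgnD deriv_prod mulr_sumr; apply: eq_bigr => j _; congr (_ * _).
  rewrite [RHS](bigD1 j)//= mxE eqxx; congr (_ * _).
  by apply: eq_bigr => i /negbTE ij; rewrite mxE ij.
rewrite /mxtrace [RHS](eq_bigr (fun i => \sum_j (A j i)^`() * cofactor A j i)); last first.
  by move=> i _; rewrite mxE; apply: eq_bigr => j _; rewrite !mxE mulrC.
rewrite [RHS]exchange_big /=; apply: eq_bigr => j _; rewrite (expand_det_row _ j).
apply: eq_bigr => i _; rewrite mxE eqxx; congr (_ * _).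
rewrite /cofactor; congr (_ * \det _).
by apply/matrixP => k l; rewrite !mxE eq_sym (negbTE (neq_lift _ _)).
Qed.

Section LogDet.
Variables (R : realType) (n : nat) (A : 'M[R]_n).

Definition const_pow (k : nat) : 'M[{poly R}]_n := map_mx polyC (A ^+ k).

(** Partial sums of the formal series - log det(I - XA). *)
Definition trace_sum (m : nat) : {poly R} :=
  \sum_(k < m) ((\tr (A ^+ k.+1)) / k.+1%:R) *: 'X^(k.+1).

Definition pencil : 'M[{poly R}]_n := 1%:M - 'X *: const_pow 1.

Lemma pencil_geometric m :
  pencil *m (\sum_(k < m) 'X^k *: const_pow k.+1) = const_pow 1 - 'X^m *: const_pow m.+1.
Proof.
elim: m => [|m IH]; first by rewrite big_ord0 mulmx0 expr0 scale1r subrr.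
rewrite big_ord_recr /= mulmxDr IH -addrA; congr (_ + _).
rewrite /pencil mulmxBl mul1mx -!scalemxAl -scalemxAr scalerA -exprS.
rewrite addrA addNr add0r; congr (- (_ *: _)).
by rewrite /const_pow -map_mxM/= expr1 [in RHS]exprS.
Qed.

Lemma deriv_trace_sum m :
  (trace_sum m)^`() = \tr (\sum_(k < m) 'X^k *: const_pow k.+1).
Proof.
rewrite /trace_sum !raddf_sum /=; apply: eq_bigr => k _.
rewrite derivZ derivXn /= mxtraceZ.
have -> : \tr (const_pow k.+1) = (\tr (A ^+ k.+1))%:P.
  by rewrite /mxtrace raddf_sum /=; apply: eq_bigr => i _; rewrite mxE.
by rewrite [RHS]mulrC mul_polyC -scalerMnr scalerMnl -mulr_natr divfK // pnatr_eq0.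
Qed.

Lemma deriv_det_pencil :
  (\det pencil)^`() = - \tr (\adj pencil *m const_pow 1).
Proof.
rewrite deriv_det (_ : map_mx _ _ = - const_pow 1) ?mulmxN ?raddfN//.
apply/matrixP => i j; rewrite !mxE derivB derivM derivX mul1r !derivC mulr0 addr0.
by case: (i == j); rewrite ?mulr1n ?mulr0n ?derivC ?sub0r //.
Qed.

(** If trace_sum were the full series the right side would be 0, as det(I - XA)
    exp(- log det(I - XA)) is constant.  The finite sum leaves the remainder of
    a truncated geometric series, which needs no convergence. *)
Lemma pencil_log_derivative m :
  (\det pencil)^`() + \det pencil * (trace_sum m)^`() =
  - ('X^m * \tr (\adj pencil *m const_pow m.+1)).
Proof.
rewrite deriv_trace_sum deriv_det_pencil -mxtraceZ -mul_scalar_mx -mul_adj_mx.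
by rewrite -mulmxA pencil_geometric mulmxBr raddfB /= addrA addNr add0r -scalemxAr mxtraceZ.
Qed.

End LogDet.

Import numFieldNormedType.Exports.
Local Open Scope classical_set_scope.

(** * Exponential of the trace series *)

Lemma horner_bounded (R : realType) (p : {poly R}) :
  exists C, forall t, 0 <= t <= 1 -> `|p.[t]| <= C.
Proof.
exists (\sum_(i < size p) `|p`_i|) => t /andP[t0 t1].
rewrite horner_coef (le_trans (ler_norm_sum _ _ _))//; apply: ler_sum => i _.
by rewrite normrM ler_piMr// normrX ger0_norm// exprn_ile1.
Qed.

Lemma cvg_finsum (R : realType) (I : finType) (f : I -> nat -> R) (l : I -> R) :
  (forall i, f i m @[m --> \oo] --> l i) ->
  \sum_i f i m @[m --> \oo] --> \sum_i l i.
Proof. by move=> fl; apply: cvg_big => [|i _]; [exact: add_continuous|exact: fl]. Qed.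

Section DetExp.
Variables (R : realType) (n : nat) (A : 'M[R]_n).

Let logdet (m : nat) : R := \sum_(k < m) \tr (A ^+ k.+1) / k.+1%:R.

Lemma horner_trace_sum m t :
  (trace_sum A m).[t] = \sum_(k < m) \tr (A ^+ k.+1) / k.+1%:R * t ^+ k.+1.
Proof. by rewrite horner_sum; apply: eq_bigr => k _; rewrite hornerZ hornerXn. Qed.

Lemma horner_det_pencil t : (\det (pencil A)).[t] = \det (1%:M - t *: A).
Proof.
rewrite -horner_evalE -det_map_mx; congr (\det _); apply/matrixP => i j.
rewrite !mxE expr1 /= /horner_eval hornerD hornerN hornerM hornerX hornerC.
by case: (i == j); rewrite ?mulr1n ?mulr0n ?hornerC.
Qed.

(** Mean value theorem for t |-> det(I - tA) exp(S_m(t)), whose value at 0 is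
    1 and whose derivative is bounded on [0, 1] by a constant multiple of the
    entries of A^(m+1). *)
Lemma det_exp_cvg (C : R) :
  (forall k, 0 <= \tr (A ^+ k)) ->
  (forall i j, (A ^+ k) i j @[k --> \oo] --> (0 : R)) ->
  (forall m, logdet m <= C) ->
  \det (1%:M - A) * expR (logdet m) @[m --> \oo] --> (1 : R).
Proof.
move=> tr0 A0 ldC.
have /choice[c cP] : forall ij : 'I_n * 'I_n, exists c, forall t, 0 <= t <= 1 ->
    `|((\adj (pencil A)) ij.1 ij.2).[t]| <= c by move=> ij; exact: horner_bounded.
pose err m : R := expR C * \sum_i \sum_j c (i, j) * `|(A ^+ m.+1) j i|.
have err0 : err m @[m --> \oo] --> (0 : R).
  have : \sum_i \sum_j c (i, j) * `|(A ^+ m.+1) j i| @[m --> \oo] -->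
      \sum_i \sum_j c (i, j) * `|0 : R|.
    apply: cvg_finsum => i; apply: cvg_finsum => j.
    apply: cvgM; first exact: cvg_cst.
    by apply: cvg_norm; rewrite (cvg_shiftS (fun m => (A ^+ m) j i)); exact: A0.
  have -> : \sum_i \sum_j c (i, j) * `|0 : R| = 0.
    by rewrite big1// => i _; rewrite big1// => j _; rewrite normr0 mulr0.
  move=> h.
  by rewrite -(mulr0 (expR C)); apply: cvgM; [exact: cvg_cst|exact: h].
(* det(I - tA) exp(S_m(t)) *)
pose f m (t : R) := (\det (pencil A)).[t] * expR (trace_sum A m).[t].
have df m (t : R) : is_derive t 1 (f m)
   (- (expR (trace_sum A m).[t] * t ^+ m *
     (\tr (\adj (pencil A) *m const_pow A m.+1)).[t])).
  have h1 := is_derive_poly (\det (pencil A)) t.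
  have h2 := is_derive_poly (trace_sum A m) t.
  have h3 : is_derive t 1 (expR \o horner (trace_sum A m))
     (expR (trace_sum A m).[t] * (trace_sum A m)^`().[t]).
    exact: is_derive1_comp.
  apply: is_derive_eq (is_deriveM h1 h3) _.
  have /(congr1 (horner^~ t)) := pencil_log_derivative A m.
  rewrite hornerN hornerM hornerXn hornerD hornerM => e.
  rewrite -[in RHS]mulrA -[RHS]mulrN -e /= /GRing.scale/=; ring.
have fE m : \det (1%:M - A) * expR (logdet m) = f m 1.
  rewrite /f horner_det_pencil scale1r horner_trace_sum; congr (_ * expR _).
  by apply: eq_bigr => k _; rewrite expr1n mulr1.
have f0 m : f m 0 = 1.
  rewrite /f horner_det_pencil scale0r subr0 det1 horner_trace_sum big1 ?expR0 ?mulr1//.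
  by move=> k _; rewrite expr0n mulr0.
have ferr m : `|f m 1 - 1| <= err m.
  have cf : {within `[0, 1], continuous (f m)}.
    apply: continuous_subspaceT => x; apply: differentiable_continuous.
    by apply/derivable1_diffP; have [] := df m x.
  have [x x01] := @MVT _ (f m) _ 0 1 ltr01 (fun x _ => df m x) cf.
  rewrite subr0 mulr1 f0 => ->; rewrite normrN normrM.
  move: x01; rewrite in_itv /= => /andP[/ltW x0 /ltW x1].
  apply: ler_pM => //.
    rewrite ger0_norm ?mulr_ge0 ?expR_ge0 ?exprn_ge0//.
    apply: le_trans (_ : expR (trace_sum A m).[x] <= _).
      by rewrite ler_piMr ?expR_ge0// exprn_ile1.
    rewrite ler_expR; apply: le_trans (ldC m); rewrite horner_trace_sum.
    apply: ler_sum => k _; rewrite ler_piMr ?divr_ge0//.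
    by rewrite exprn_ile1.
  rewrite horner_sum (le_trans (ler_norm_sum _ _ _))//; apply: ler_sum => i _.
  rewrite mxE horner_sum (le_trans (ler_norm_sum _ _ _))//; apply: ler_sum => j _.
  rewrite hornerM !mxE hornerC normrM ler_wpM2r//.
  by have := cP (i, j) x; rewrite x0 x1 !mxE /=; apply.
under eq_fun do rewrite fE.
apply/cvgrPdist_le => e e0; near=> m.
rewrite distrC (le_trans (ferr m))//.
rewrite (le_trans (ler_norm _))//.
by near: m; move/cvgr0Pnorm_le : err0; apply.
Unshelve. all: by end_near. Qed.

End DetExp.

Section TraceWalk.
Variables (R : realType) (V : finType) (P : V -> V -> R).

Lemma expmx_walk k x y :
  (mx_of P ^+ k.+1) (enum_rank x) (enum_rank y) =
  \sum_(s : k.-tuple V) walk_weight P x s y.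
Proof.
elim: k x => [|k IH] x.
  rewrite (sum_tuple0 predT (fun s => walk_weight P x s y)).
  by rewrite expr1 mxE !enum_rankK walk_weight_nil.
rewrite (sum_tupleS _ predT (fun s => walk_weight P x s y)) /=.
rewrite exprS -[_ * _]/(_ *m _) mxE (reindex enum_rank) /=; last first.
  exact/onW_bij/enum_rank_bij.
apply: eq_bigr => z _; rewrite mxE !enum_rankK IH mulr_sumr.
by apply: eq_bigr => s _; rewrite walk_weight_cons.
Qed.

Lemma trace_walk k :
  \tr (mx_of P ^+ k.+1) = \sum_(s : k.+1.-tuple V) rooted_weight P s.
Proof.
rewrite (sum_tupleS _ predT (rooted_weight P)) /= /mxtrace (reindex enum_rank) /=; last first.
  exact/onW_bij/enum_rank_bij.
apply: eq_bigr => x _; rewrite expmx_walk.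
by apply: eq_bigr => s _; rewrite rooted_weight_walk.
Qed.

Hypothesis P0 : forall x y, 0 <= P x y.
Hypothesis Ptr : transient P.

Lemma expmx_ge0 k i j : 0 <= (mx_of P ^+ k) i j.
Proof.
elim: k i j => [|k IH] i j; first by rewrite expr0 mxE ler0n.
by rewrite exprS -[_ * _]/(_ *m _) mxE sumr_ge0// => l _; rewrite mulr_ge0// mxE.
Qed.

Lemma sum_expmx_le m x y :
  \sum_(0 <= k < m) (mx_of P ^+ k) (enum_rank x) (enum_rank y) <= fine (green P x y).
Proof.
set g := green _ _ _.
have gfin : g \is a fin_num.
  rewrite fin_numE -ltey Ptr andbT gt_eqF// (lt_le_trans (ltNyr 0))//.
  by apply: nneseries_ge0 => k _ _; rewrite lee_fin expmx_ge0.
rewrite -lee_fin fineK// -sumEFin /g /green.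
by apply: nneseries_lim_ge => k _; rewrite lee_fin expmx_ge0.
Qed.

Lemma expmx_cvg0 i j : (mx_of P ^+ k) i j @[k --> \oo] --> (0 : R).
Proof.
rewrite -(enum_valK i) -(enum_valK j).
apply: cvg_series_cvg_0; apply: nondecreasing_is_cvgn.
  by apply: nondecreasing_series => k _ _; exact: expmx_ge0.
eexists => _ [m _ <-].
exact: sum_expmx_le.
Qed.

(** The total mass of the loops of length at most m (see
    [sum_loop_measure_mass]). *)
Definition loop_mass m : R := \sum_(k < m) \tr (mx_of P ^+ k.+1) / k.+1%:R.

Lemma loop_mass_le m : loop_mass m <= \sum_x fine (green P x x).
Proof.
apply: (@le_trans _ _ (\sum_(0 <= k < m.+1) \tr (mx_of P ^+ k))).
  rewrite big_nat_recl// big_mkord ler_wpDl// ?sumr_ge0//.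
    by move=> i _; exact: expmx_ge0.
  apply: ler_sum => k _; rewrite ler_pdivrMr ?ltr0n// ler_peMr//.
    by rewrite sumr_ge0// => i _; exact: expmx_ge0.
  by rewrite ler1n.
rewrite exchange_big /= (reindex enum_rank) /=; last first.
  exact/onW_bij/enum_rank_bij.
by apply: ler_sum => x _; exact: sum_expmx_le.
Qed.

(** The product det(I - P) exp(M_m) tends to 1, which is only possible if
    det(I - P) > 0; taking logarithms gives M_m --> - ln det(I - P). *)
Lemma expR_loop_mass_cvg (a : R) :
  expR (- (a * loop_mass m)) @[m --> \oo] --> (\det (1%:M - mx_of P)) `^ a.
Proof.
set D := \det _; set C := \sum_x fine (green P x x).
have DM : D * expR (loop_mass m) @[m --> \oo] --> (1 : R).
  apply: (@det_exp_cvg _ _ _ C) => [k|i j|m].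
  - by rewrite sumr_ge0// => i _; exact: expmx_ge0.
  - exact: expmx_cvg0.
  - exact: loop_mass_le.
(* Otherwise det(I - P) exp(M_m) <= 0 could not tend to 1. *)
have D0 : 0 < D.
  rewrite ltNge; apply/negP => D0.
  have : (1 : R) <= 0.
    apply: (cvgr_to_le DM); apply: nearW => m.
    by rewrite mulr_le0_ge0 ?expR_ge0.
  by rewrite ler10.
have : D * (D * expR (loop_mass m))^-1 @[m --> \oo] --> D * 1^-1.
  by apply: cvgM; [exact: cvg_cst|apply: cvgV; rewrite ?oner_neq0].
have -> : (fun m => D * (D * expR (loop_mass m))^-1) = fun m => expR (- loop_mass m).
  apply/funext => m; rewrite expRN invfM mulrA divff ?mul1r//.
  by rewrite gt_eqF.
rewrite invr1 mulr1 => eD.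
have lnc : {for D, continuous (@ln R)} by exact: continuous_ln.
have : ln (expR (- loop_mass m)) @[m --> \oo] --> ln D by exact: cvg_comp eD lnc.
under eq_fun do rewrite expRK.
move=> lD; have aD : a * - loop_mass m @[m --> \oo] --> a * ln D.
  by apply: cvgM; [exact: cvg_cst|exact: lD].
rewrite /powR gt_eqF//; under eq_fun do rewrite -mulrN.
exact: cvg_comp aD (@continuous_expR R _).
Qed.

End TraceWalk.

(** * Rotations of sequences *)

Section Rotations.
Variable T : eqType.
Implicit Types s u v : seq T.

Lemma iter_rot1 k s : (k <= size s)%N -> iter k (rot 1) s = rot k s.
Proof.
elim: k => [|k IH] ks; first by rewrite rot0.
by rewrite iterS IH ?(ltnW ks)// -rotD ?add1n.
Qed.

(** Commuting words are powers of a common word; here u itself serves, because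
    its length divides that of v. *)
Lemma commuting_cat_nseq m u v :
  u ++ v = v ++ u -> size v = (m * size u)%N -> v = flatten (nseq m u).
Proof.
elim: m v => [|m IH] v uv; first by move=> /size0nil.
rewrite mulSn => sv.
have vE : v = u ++ drop (size u) v.
  rewrite -[LHS](cat_take_drop (size u)); congr (_ ++ _).
  have := congr1 (take (size u)) uv.
  by rewrite take_size_cat// takel_cat// sv leq_addr.
rewrite vE /=; congr (_ ++ _); apply: IH; last by rewrite size_drop sv addKn.
by move: uv; rewrite {1 2}vE -catA => /eqP; rewrite eqseq_cat// => /andP[_ /eqP].
Qed.

Lemma rot_period_flatten m p s : rot p s = s -> (p <= size s)%N -> size s = (m * p)%N ->
  s = flatten (nseq m (take p s)).
Proof.
move=> rs ps sE; case: m sE => [/size0nil-> //|m sE].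
rewrite -[LHS](cat_take_drop p) /=; congr (_ ++ _).
apply: commuting_cat_nseq; first by rewrite cat_take_drop -[LHS]rs.
by rewrite size_takel// size_drop sE mulSn addKn.
Qed.

Lemma rot_nseq_flatten j u : rot (size u) (flatten (nseq j u)) = flatten (nseq j u).
Proof.
case: j => // j; rewrite /= rot_size_cat.
by elim: j => [|j IH] /=; rewrite ?cats0// -catA IH.
Qed.

Variable s : seq T.
Hypothesis s0 : (0 < size s)%N.

Definition is_period p := (0 < p)%N && (iter p (rot 1) s == s).

Lemma size_is_period : is_period (size s).
Proof. by rewrite /is_period s0 iter_rot1// rot_size eqxx. Qed.

(** Iterates of [rot 1] are used rather than [rot] because [rot k s] is s as
    soon as k >= size s, so that [rot] is not additive in k. *)
Definition period : nat := ex_minn (ex_intro is_period (size s) size_is_period).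

Lemma period_gt0 : (0 < period)%N.
Proof. by rewrite /period; case: ex_minnP => p /andP[]. Qed.

Lemma iter_period_mul k : iter (k * period) (rot 1) s = s.
Proof.
have ps : iter period (rot 1) s = s.
  by rewrite /period; case: ex_minnP => p /andP[_ /eqP].
by elim: k => // k IH; rewrite mulSn iterD IH.
Qed.

Lemma iter_period_mod i : iter i (rot 1) s = iter (i %% period) (rot 1) s.
Proof. by rewrite {1}(divn_eq i period) addnC iterD iter_period_mul. Qed.

Lemma dvd_period i : iter i (rot 1) s = s -> (period %| i)%N.
Proof.
rewrite iter_period_mod => e; rewrite /dvdn -leqn0 leqNgt; apply/negP => i0.
suff : (period <= i %% period)%N by rewrite leqNgt ltn_pmod// period_gt0.
rewrite [X in (X <= _)%N]/period; case: ex_minnP => p _; apply.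
by rewrite /is_period i0; apply/eqP.
Qed.

Lemma iter_rot1_inj k : injective (iter k (rot 1) : seq T -> seq T).
Proof. by elim: k => // k IH a b /= /rot_inj /IH. Qed.

Lemma iter_period_inj i j : (i < period)%N -> (j < period)%N ->
  iter i (rot 1) s = iter j (rot 1) s -> i = j.
Proof.
wlog ij : i j / (i <= j)%N.
  by move=> H ip jp; case: (leqP i j) => [/H|/ltnW /H h e]; [apply|rewrite h].
move=> ip jp; rewrite -(subnKC ij) iterD => /iter_rot1_inj/esym/dvd_period.
have := leq_ltn_trans (leq_subr i j) jp.
case: (posnP (j - i)%N) => [-> _ _|]; first by rewrite addn0.
by move=> h1 h2 /(dvdn_leq h1); rewrite leqNgt h2.
Qed.

Lemma period_dvd_size : (period %| size s)%N.
Proof. by apply: dvd_period; rewrite iter_rot1// rot_size. Qed.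

End Rotations.

Lemma sum_modn (R : nmodType) (F : nat -> R) m p : (0 < p)%N ->
  \sum_(0 <= i < m * p) F (i %% p)%N = (\sum_(0 <= i < p) F i) *+ m.
Proof.
move=> p0; elim: m => [|m IH]; first by rewrite mul0n big_geq.
rewrite mulSn (@big_cat_nat _ _ _ p)//= ?leq_addr// mulrS; congr (_ + _).
  by apply: eq_big_nat => i /andP[_ ip]; rewrite modn_small.
rewrite -IH -[X in index_iota X _]add0n big_addn addKn.
by apply: eq_big_nat => i _; rewrite modnDr.
Qed.

(** * From unrooted to rooted loops *)

Lemma cycle_prefix (T : eqType) (e : rel T) u v :
  u != [::] -> u ++ v = v ++ u -> cycle e (u ++ v) -> cycle e u.
Proof.
case: u => // x u _ uv; rewrite /= !rcons_cat !path.cat_path => /andP[pu].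
case: v uv => [|y v] /=; first by move=> _ h; rewrite -cats1 path.cat_path pu.
by move=> [<- _] /andP[h _]; rewrite -cats1 path.cat_path pu /= h.
Qed.

Section LoopCounting.
Local Open Scope quotient_scope.
Variables (R : realType) (V : finType) (P : V -> V -> R).

Notation points g := (val (repr g)).

Lemma size_rooted (s : rooted_loop P) : (0 < size (val s))%N.
Proof. by have /andP[] := valP s; rewrite -size_eq0 lt0n. Qed.

(** Allowing all iterates makes this characterization compatible with
    reduction modulo the period. *)
Lemma eq_pi_iter (s t : rooted_loop P) :
  reflect (exists k, val t = iter k (rot 1) (val s))
    (\pi_(unrooted_loop P) t == \pi_(unrooted_loop P) s).
Proof.
rewrite eq_sym (eqmodE (shift_equiv P) s t); apply: (iffP (shift_relP s t)) => -[k ->].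
  case: (leqP k (size (val s))) => ks; first by exists k; rewrite iter_rot1.
  by exists 0%N; rewrite rot_oversize// ltnW.
exists (k %% period (size_rooted s))%N; rewrite (iter_period_mod (size_rooted s)).
rewrite iter_rot1// ltnW// (leq_trans (ltn_pmod _ (period_gt0 _)))//.
by rewrite dvdn_leq ?size_rooted// period_dvd_size.
Qed.

Definition loop_period (g : unrooted_loop P) : nat := period (size_rooted (repr g)).

(** A loop that is the concatenation of j copies of u is fixed by the rotation
    of size u, hence the period divides size u; conversely the prefix of length
    the period is itself a rooted loop whose powers give the loop. *)
Lemma multiplicityE (g : unrooted_loop P) : multiplicity g = (size (points g) %/ loop_period g)%N.
Proof.
have s0 := size_rooted (repr g).
have p0 : (0 < loop_period g)%N by exact: period_gt0.
have pd : (loop_period g %| size (points g))%N by exact: period_dvd_size.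
apply/eqP; rewrite eqn_leq; apply/andP; split.
  apply/bigmax_leqP => j0 /asboolP[s [t [sg]]]; move: (nat_of_ord j0) => j {j0} st.
  rewrite leq_divRL//; case: (posnP j) => [->//|j0].
  have [k sk] : exists k, val s = iter k (rot 1) (points g).
    by apply/eq_pi_iter; rewrite sg reprK.
  have szt : size (points g) = (j * size (val t))%N.
    have <- : size (val s) = size (points g).
      rewrite sk; elim: k {sk} => //= k IH; by rewrite size_rot.
    by rewrite st size_flatten /shape map_nseq sumn_nseq mulnC.
  rewrite szt leq_pmul2l//; apply: dvdn_leq; first exact: size_rooted.
  apply: dvd_period; apply: (@iter_rot1_inj _ k).
  rewrite -iterD addnC iterD -sk iter_rot1; last first.
    by rewrite st size_flatten /shape map_nseq sumn_nseq leq_pmulr.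
  by rewrite st rot_nseq_flatten.
have jb : (size (points g) %/ loop_period g < (size (points g)).+1)%N.
  by rewrite ltnS leq_div.
apply: (@leq_bigmax_cond _ _ (fun j => nat_of_ord j) (Ordinal jb)); apply/asboolP.
have pn : (loop_period g <= size (points g))%N by exact: dvdn_leq.
have rs : rot (loop_period g) (points g) = points g.
  by rewrite -iter_rot1// -[X in iter X]mul1n; exact: iter_period_mul.
have uP : (take (loop_period g) (points g) != [::]) &&
    cycle (edge P) (take (loop_period g) (points g)).
  have u0 : take (loop_period g) (points g) != [::].
    by rewrite -size_eq0 size_takel// -lt0n.
  rewrite u0 /=; apply: (@cycle_prefix _ _ _ (drop (loop_period g) (points g))) => //.
    by rewrite cat_take_drop -[LHS]rs.
  by rewrite cat_take_drop; have /andP[] := valP (repr g).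
exists (repr g), (Sub (take (loop_period g) (points g)) uP : rooted_loop P).
split; first by rewrite reprK.
by rewrite SubK; apply: rot_period_flatten => //; rewrite divnK.
Qed.

Lemma multiplicity_gt0 (g : unrooted_loop P) : (0 < multiplicity g)%N.
Proof.
rewrite multiplicityE divn_gt0 ?period_gt0//.
by rewrite dvdn_leq ?size_rooted// period_dvd_size.
Qed.

Fixpoint all_seqs n : seq (seq V) :=
  if n is m.+1 then all_seqs m ++ [seq tval t | t <- enum {: n.-tuple V}] else [::].

Lemma mem_all_seqs n s : (s \in all_seqs n) = (0 < size s <= n)%N.
Proof.
elim: n => [|n IH] /=; first by case: s.
rewrite mem_cat IH; have -> : (s \in [seq tval t | t <- enum {: n.+1.-tuple V}]) = (size s == n.+1).
  apply/mapP/eqP => [[t _ ->]|sn]; first by rewrite size_tuple.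
  by exists (tcast sn (in_tuple s)); rewrite ?mem_enum// val_tcast.
by rewrite [(_ <= n.+1)%N]leq_eqVlt ltnS andb_orr orbC; case: eqP => [->|_]; rewrite ?andbF.
Qed.

Lemma uniq_all_seqs n : uniq (all_seqs n).
Proof.
elim: n => //= n IH; rewrite cat_uniq IH map_inj_uniq ?enum_uniq ?andbT//; last exact: val_inj.
apply/hasPn => _ /mapP[t _ ->]; apply/negP; by rewrite mem_all_seqs size_tuple ltnn andbF.
Qed.

Lemma sum_all_seqs n (F : seq V -> R) :
  \sum_(s <- all_seqs n) F s = \sum_(k < n) \sum_(t : k.+1.-tuple V) F t.
Proof.
elim: n => [|n IH] /=; first by rewrite big_nil big_ord0.
by rewrite big_cat big_ord_recr /= IH big_map big_enum.
Qed.

Definition rooted_upto n : seq (rooted_loop P) := pmap insub (all_seqs n).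

Definition loops_upto n : seq (unrooted_loop P) :=
  undup (map (\pi_(unrooted_loop P)) (rooted_upto n)).

Lemma mem_rooted_upto n s : (s \in rooted_upto n) = (size (val s) <= n)%N.
Proof. by rewrite mem_pmap_sub mem_all_seqs size_rooted. Qed.

Lemma uniq_rooted_upto n : uniq (rooted_upto n).
Proof. exact/pmap_sub_uniq/uniq_all_seqs. Qed.

Lemma size_pi (s : rooted_loop P) : size (points (\pi_(unrooted_loop P) s)) = size (val s).
Proof. by have [k ->] := repr_shift s; rewrite size_rot. Qed.

Lemma mem_loops_upto n (g : unrooted_loop P) : (g \in loops_upto n) = (size (points g) <= n)%N.
Proof.
rewrite mem_undup; apply/mapP/idP => [[s]|gn].
  by rewrite mem_rooted_upto => sn ->; rewrite size_pi.
by exists (repr g); rewrite ?mem_rooted_upto// reprK.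
Qed.

(** A sequence that is not a loop along edges takes a step of zero probability,
    so the sums may run over all sequences. *)
Lemma rooted_weight_cycle s : s != [::] -> ~~ cycle (edge P) s -> rooted_weight P s = 0.
Proof.
case: s => // x s _; rewrite rooted_weight_walk /=.
move: {1 3}x => z; elim: s z => [|y s IH] z /=.
  by rewrite andbT /edge /= negb_or negbK => /andP[/eqP Pzx _]; rewrite walk_weight_nil.
rewrite walk_weight_cons negb_and => /orP[|/IH ->]; last by rewrite mulr0.
by rewrite /edge /= negb_or negbK => /andP[/eqP -> _]; rewrite mul0r.
Qed.

Lemma sum_rooted_upto n (F : seq V -> R) :
  (forall s, s != [::] -> ~~ cycle (edge P) s -> F s = 0) ->
  \sum_(s <- rooted_upto n) F (val s) = \sum_(k < n) \sum_(t : k.+1.-tuple V) F t.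
Proof.
move=> F0; rewrite -sum_all_seqs -(big_map val predT F).
rewrite pmap_filter ?big_filter; last exact: insubK.
rewrite [RHS](bigID (fun s => insub s : option (rooted_loop P))) /=.
rewrite [X in _ = _ + X]big_seq_cond [X in _ = _ + X]big1 ?addr0// => s.
rewrite mem_all_seqs => /andP[/andP[s0 _]]; case: insubP => // sP _.
have sn : s != [::] by rewrite -size_eq0 -lt0n.
by apply: F0 => //; move: sP; rewrite sn.
Qed.

(** The distinct rootings of g are its first (period) rotations, and the size
    of g is (multiplicity) times the period. *)
Lemma sum_class (g : unrooted_loop P) n (F : seq V -> R) : (size (points g) <= n)%N ->
  \sum_(s <- rooted_upto n | \pi_(unrooted_loop P) s == g) F (val s) =
  (multiplicity g)%:R^-1 * \sum_(i < size (points g)) F (rot i (points g)).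
Proof.
move=> gn.
have p0 : (0 < loop_period g)%N by exact: period_gt0.
pose it i := iter i (rot 1) (points g).
transitivity (\sum_(0 <= i < loop_period g) F (it i)).
  rewrite -big_filter -(big_map val predT F) -(big_map it predT F).
  apply: perm_big; apply: uniq_perm.
  - by rewrite map_inj_uniq ?filter_uniq ?uniq_rooted_upto//; exact: val_inj.
  - rewrite map_inj_in_uniq ?iota_uniq// => i j; rewrite !mem_index_iota => ip jp.
    exact: (@iter_period_inj _ _ (size_rooted (repr g))).
  move=> s; apply/mapP/mapP => [[t]|[i]].
    rewrite mem_filter -{1}[g]reprK => /andP[/eq_pi_iter[k tk] _] ->.
    exists (k %% loop_period g)%N; first by rewrite mem_index_iota ltn_pmod.
    by rewrite tk; exact: iter_period_mod.
  rewrite mem_index_iota => /andP[_ ip] ->.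
  have iE : it i = rot i (points g).
    by rewrite /it iter_rot1// ltnW// (leq_trans ip)// dvdn_leq ?size_rooted// period_dvd_size.
  have iP : (it i != [::]) && cycle (edge P) (it i).
    rewrite iE rot_cycle -size_eq0 size_rot size_eq0; exact: (valP (repr g)).
  exists (Sub (it i) iP : rooted_loop P) => //; rewrite mem_filter mem_rooted_upto SubK.
  apply/andP; split; last by rewrite iE size_rot.
  by rewrite -[X in _ == X]reprK; apply/eq_pi_iter; exists i; rewrite SubK.
have -> : \sum_(i < size (points g)) F (rot i (points g)) =
    (\sum_(0 <= i < loop_period g) F (it i)) *+ multiplicity g.
  rewrite multiplicityE -(sum_modn (fun i => F (it i)))// divnK ?period_dvd_size//.
  rewrite big_mkord; apply: eq_bigr => i _; congr F.
  rewrite /it -(iter_period_mod (size_rooted (repr g))) iter_rot1//.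
  exact: ltnW.
by rewrite -[X in _^-1 * X]mulr_natl mulKf// pnatr_eq0 -lt0n multiplicity_gt0.
Qed.

(** The weight 1/J of the loop measure cancels the J-fold repetition of the
    rootings in the list of all rotations. *)
Lemma sum_loop_measure n (F : seq V -> R) :
  \sum_(g <- loops_upto n) loop_measure g * \sum_(i < size (points g)) F (rot i (points g)) =
  \sum_(k < n) \sum_(t : k.+1.-tuple V) rooted_weight P t * F t.
Proof.
rewrite -(@sum_rooted_upto n (fun s => rooted_weight P s * F s)); last first.
  by move=> s s0 /(rooted_weight_cycle s0) ->; rewrite mul0r.
transitivity (\sum_(s <- rooted_upto n) \sum_(g <- loops_upto n | \pi_(unrooted_loop P) s == g)
    rooted_weight P (val s) * F (val s)).
  rewrite (exchange_big_dep predT)//= big_seq [RHS]big_seq; apply: eq_bigr => g.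
  rewrite mem_loops_upto => gn.
  rewrite /loop_measure mulrAC -(@sum_class g n)// mulr_suml.
  by apply: eq_bigr => s /eqP <-; rewrite rooted_weight_pi mulrC.
rewrite big_seq [RHS]big_seq; apply: eq_bigr => s sn.
rewrite -big_filter (_ : [seq _ <- _ | _] = [:: \pi_(unrooted_loop P) s]) ?big_seq1//.
rewrite (eq_filter (a2 := pred1 (\pi_(unrooted_loop P) s))); last by move=> g; exact: eq_sym.
by apply: filter_pred1_uniq; rewrite ?undup_uniq// mem_undup map_f.
Qed.

End LoopCounting.

(** * Poisson configurations *)

Section Configurations.
Variables (R : realType) (V I : finType) (rate : I -> R) (v : I -> V -> nat).
Hypothesis v_gt0 : forall i, (0 < mass (v i))%N.

(** A configuration gives the number c i of points at i, truncated at n so that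
    configurations form a finite type; [conf_le_mass] shows that the truncation
    is harmless for |q| <= n. *)
Definition conf_sum n (c : {ffun I -> 'I_n.+1}) : V -> nat := fun x => (\sum_i c i * v i x)%N.

Definition conf_weight n (c : {ffun I -> 'I_n.+1}) : R := \prod_i (rate i ^+ c i / (c i)`!%:R).

Definition hits n (q : V -> nat) (c : {ffun I -> 'I_n.+1}) : bool :=
  [forall x, conf_sum c x == q x].

Definition poisson_coef n (q : V -> nat) : R :=
  \sum_(c : {ffun I -> 'I_n.+1} | hits q c) conf_weight c.

Lemma hitsP n q (c : {ffun I -> 'I_n.+1}) : reflect (conf_sum c = q) (hits q c).
Proof.
by apply: (iffP forallP) => [h|<- x//]; apply/funext => x; exact/eqP.
Qed.

Lemma mass_conf_sum n (c : {ffun I -> 'I_n.+1}) : mass (conf_sum c) = (\sum_i c i * mass (v i))%N.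
Proof. by rewrite /mass exchange_big; apply: eq_bigr => i _; rewrite -big_distrr. Qed.

Lemma conf_le_mass n (c : {ffun I -> 'I_n.+1}) i : (c i <= mass (conf_sum c))%N.
Proof.
by rewrite mass_conf_sum (bigD1 i)//= (leq_trans _ (leq_addr _ _))// leq_pmulr.
Qed.

(** Removing one point at i is a bijection from the configurations that hit q
    with c i > 0 to those that hit q - v i, and c r^c / c! = r r^(c-1) / (c-1)!. *)
Lemma poisson_coef_shift n q i : (mass q <= n)%N ->
  \sum_(c : {ffun I -> 'I_n.+1} | hits q c) (c i)%:R * conf_weight c =
  if leqf (v i) q then rate i * poisson_coef n (qsub q (v i)) else 0.
Proof.
move=> qn.
have lecs (c : {ffun I -> 'I_n.+1}) : (0 < c i)%N -> leqf (v i) (conf_sum c).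
  move=> ci; apply/forallP => x; rewrite /conf_sum (bigD1 i)//=.
  by rewrite (leq_trans _ (leq_addr _ _))// leq_pmull.
rewrite (bigID (fun c : {ffun I -> 'I_n.+1} => (0 < c i)%N)) /= addrC big1 ?add0r; last first.
  by move=> c /andP[_]; rewrite -eqn0Ngt => /eqP ->; rewrite mul0r.
case: ifPn => [vq|nvq]; last first.
  by rewrite big1// => c /andP[/hitsP hq /lecs]; rewrite hq (negbTE nvq).
(* [inord] sends n + 1 to 0, so adding a point at a full index i gives a
   configuration empty at i, which the condition 0 < c i excludes. *)
pose upd (k : nat) (c : {ffun I -> 'I_n.+1}) : {ffun I -> 'I_n.+1} :=
  [ffun j => if j == i then inord k else c j].
pose up (c : {ffun I -> 'I_n.+1}) := upd (c i).+1 c.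
pose down (c : {ffun I -> 'I_n.+1}) := upd (c i).-1 c.
have updi k c : (k <= n)%N -> upd k c i = k :> nat.
  by move=> kn; rewrite ffunE eqxx inordK.
have updj k c j : j != i -> upd k c j = c j by move=> /negbTE ji; rewrite ffunE ji.
rewrite (reindex_onto up down) /=; last first.
  move=> c /andP[_ ci]; apply/ffunP => j; rewrite /up /down.
  have [->|ji] := eqVneq j i; last by rewrite !updj.
  apply: val_inj; have cin := ltn_ord (c i).
  by rewrite /= updi ?updi ?prednK//; lia.
have upE (c : {ffun I -> 'I_n.+1}) : (c i < n)%N ->
    conf_sum (up c) = fun x => (v i x + conf_sum c x)%N.
  move=> cn; apply/funext => x; rewrite /conf_sum (bigD1 i)//= updi// mulSn -addnA.
  congr (_ + _)%N; rewrite [in RHS](bigD1 i)//=; congr (_ + _)%N.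
  by apply: eq_bigr => j ji; rewrite updj.
have up_lt (c : {ffun I -> 'I_n.+1}) : (0 < up c i)%N -> (c i < n)%N.
  move=> ci; rewrite ltnNge; apply/negP => nc; move: ci; rewrite /up /upd ffunE eqxx.
  have -> : (c i).+1 = n.+1 by have := ltn_ord (c i); lia.
  by rewrite /inord /insubd insubF ?ltnn.
rewrite mulr_sumr; apply: eq_big => c.
  apply/idP/idP => [/andP[/andP[/hitsP hq ci] _]|/hitsP hq].
    have cn := up_lt _ ci.
    by apply/hitsP; rewrite -hq upE//; apply/funext => x; rewrite /qsub addKn.
  have cn : (c i < n)%N.
    apply: leq_ltn_trans (conf_le_mass c i) _; rewrite hq.
    rewrite -(leq_add2l (mass (v i))) addnS -mass_qsub//.
    by apply: leq_ltn_trans qn _; rewrite -[X in (X < _)%N]add0n ltn_add2r.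
  rewrite updi//= andbT; apply/andP; split.
    apply/hitsP; rewrite upE//; apply/funext => x; rewrite hq /qsub subnKC//.
    exact/(forallP vq).
  apply/eqP/ffunP => j; rewrite /down.
  have [->|ji] := eqVneq j i; last by rewrite !updj.
  by apply: val_inj; rewrite /= updi updi//= ltnW.
move=> /andP[/andP[/hitsP hq ci] _].
have cn := up_lt _ ci.
rewrite /conf_weight (bigD1 i)//= [in RHS](bigD1 i)//= updi//.
rewrite (eq_bigr (fun j => rate j ^+ c j / (c j)`!%:R)); last by move=> j ji; rewrite updj.
rewrite !mulrA; congr (_ * _); rewrite exprS factS natrM.
have : (c i)`!%:R != 0 :> R by rewrite pnatr_eq0 -lt0n fact_gt0.
have : (c i).+1%:R != 0 :> R by rewrite pnatr_eq0.
move: ((c i).+1%:R : R) ((c i)`!%:R : R) => a b a0 b0.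
by field; rewrite a0 b0.
Qed.

(** Write q_x as the sum over i of c i * v i x and remove one point at i. *)
Lemma poisson_coef_rec n q x : (mass q <= n)%N ->
  (q x)%:R * poisson_coef n q =
  \sum_i (v i x)%:R * (if leqf (v i) q then rate i * poisson_coef n (qsub q (v i)) else 0).
Proof.
move=> qn; under [RHS]eq_bigr do rewrite -poisson_coef_shift// mulr_sumr.
rewrite exchange_big /= mulr_sumr; apply: eq_bigr => c /hitsP <-.
rewrite /conf_sum natr_sum mulr_suml; apply: eq_bigr => i _.
by rewrite natrM mulrA (mulrC (v i x)%:R).
Qed.

Lemma poisson_coef0 n : poisson_coef n (fun=> 0%N) = 1.
Proof.
rewrite /poisson_coef (bigD1 [ffun=> ord0])/=; last first.
  by apply/hitsP/funext => x; rewrite /conf_sum big1// => i _; rewrite ffunE.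
rewrite [X in X + _]big1 => [|i _]; last by rewrite ffunE expr0 fact0 divr1.
rewrite big1 ?addr0// => c /andP[/hitsP c0 /eqP[]].
apply/ffunP => i; rewrite ffunE; apply/val_inj/eqP; rewrite /= -leqn0.
by have := conf_le_mass c i; rewrite c0 /mass big1.
Qed.

End Configurations.

Section LoopCoefficients.
Local Open Scope quotient_scope.
Variables (R : realType) (V : finType) (P : V -> V -> R) (alpha : R).

Notation points g := (val (repr g)).

Definition nth_loop n (i : 'I_(size (loops_upto P n))) : unrooted_loop P :=
  tnth (in_tuple (loops_upto P n)) i.

Definition loop_coef n (q : V -> nat) : R :=
  poisson_coef (fun i => alpha * loop_measure (@nth_loop n i))
    (fun i => visits (@nth_loop n i)) n q.

Lemma mass_visits (g : unrooted_loop P) : mass (visits g) = size (points g).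
Proof. exact: mass_cnt. Qed.

Lemma cnt_rot i (s : seq V) : cnt (rot i s) = cnt s.
Proof. by apply/funext => x; apply: seq.permP; rewrite perm_rot. Qed.

(** Each visit of x is the starting point of exactly one rotation. *)
Lemma sum_ohead_rot (s : seq V) x :
  (\sum_(i < size s) (ohead (rot i s) == Some x) = cnt s x)%N.
Proof.
rewrite /cnt -sum1_count [RHS]big_mkcond [RHS](big_nth x) [RHS]big_mkord; apply: eq_bigr => i _.
by rewrite /rot (drop_nth x) //=; case: (_ == x).
Qed.

(** The weight v_x(g) mu(g) of an unrooted loop is the total weight of its
    rootings at x. *)
Lemma loop_coef_recursion n : loop_recursion P alpha n (loop_coef n).
Proof.
move=> q x qn; rewrite /loop_coef poisson_coef_rec//; last first.
  by move=> i; rewrite mass_visits size_rooted.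
(* The term of the recursion, restricted to sequences that start at x. *)
pose F (t : seq V) : R := (ohead t == Some x)%:R *
  (if leqf (cnt t) q then loop_coef n (qsub q (cnt t)) else 0).
transitivity (alpha * \sum_(g <- loops_upto P n) loop_measure g *
    \sum_(i < size (points g)) F (rot i (points g))).
  rewrite mulr_sumr [in RHS]big_tnth; apply: eq_bigr => i _.
  rewrite -/(nth_loop i); set g := nth_loop i.
  have -> : \sum_(i0 < size (points g)) F (rot i0 (points g)) = (visits g x)%:R *
    (if leqf (visits g) q then loop_coef n (qsub q (visits g)) else 0).
    rewrite -[visits g]/(cnt (points g)) -sum_ohead_rot natr_sum mulr_suml.
    by apply: eq_bigr => j _; rewrite /F cnt_rot.
  case: ifP => _; last by rewrite !mulr0.
  by rewrite -/(loop_coef n _) -mulrA mulrCA; congr (_ * _); rewrite mulrCA.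
rewrite sum_loop_measure; congr (_ * _); apply: eq_bigr => k _.
rewrite (sum_tupleS _ predT (fun t => rooted_weight P t * F t)) /= (bigD1 x)//=.
rewrite [X in _ + X]big1 => [|y /negbTE yx]; last first.
  by rewrite big1// => t _; rewrite /F /= (_ : (Some y == Some x) = false) ?mul0r ?mulr0//.
rewrite addr0 [RHS]big_mkcond; apply: eq_bigr => t _.
by rewrite /F /= eqxx mul1r; case: ifP => _; rewrite ?mulr0.
Qed.

Lemma loop_coefE n q : (mass q <= n)%N -> loop_coef n q = per_coef P alpha q.
Proof.
apply: loop_recursion_unique (@loop_coef_recursion n) (@per_coef_recursion _ _ _ _ n) _ _.
rewrite per_coef0 /loop_coef poisson_coef0// => i.
by rewrite mass_visits size_rooted.
Qed.

(** Give each rooting the weight 1/size: the rotations of a loop then sum to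
    one, and the rooted loops of length k to tr(P^k)/k. *)
Lemma sum_loop_measure_mass n :
  \sum_(g <- loops_upto P n) loop_measure g = loop_mass P n.
Proof.
transitivity (\sum_(g <- loops_upto P n) loop_measure g *
    \sum_(i < size (points g)) (size (rot i (points g)))%:R^-1).
  apply: eq_bigr => g _; rewrite -[LHS]mulr1; congr (_ * _).
  under eq_bigr do rewrite size_rot.
  by rewrite sumr_const card_ord -[RHS]mulr_natl divff// pnatr_eq0 -lt0n size_rooted.
rewrite (sum_loop_measure P n (fun s => (size s)%:R^-1)); apply: eq_bigr => k _.
rewrite trace_walk mulr_suml; apply: eq_bigr => t _.
by rewrite size_tuple.
Qed.

End LoopCoefficients.

(** * The law of the occupation field *)

Lemma poisson_prob_set1 (R : realType) (r : R) k : 0 <= r ->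
  poisson_prob r 0 [set k] = (r ^+ k / k`!%:R * expR (- r))%:E.
Proof.
rewrite le_eqVlt /poisson_prob => /predU1P[<-|r0].
  rewrite ltxx oppr0 expR0 mulr1 diracE.
  case: k => [|k]; first by rewrite mem_set// expr0 fact0 divr1.
  by rewrite memNset// expr0n mul0r.
rewrite r0 esum_set1; first by rewrite /poisson_pmf r0.
by rewrite lee_fin poisson_pmf_ge0.
Qed.

Section PartialOccupation.
Context (d : measure_display) (Omega : measurableType d) (R : realType).
Variables (Pr : probability Omega R) (V : finType) (P : V -> V -> R) (alpha : R).
Variable N : unrooted_loop P -> {RV Pr >-> nat}.
Hypothesis P_ge0 : forall x y, 0 <= P x y.
Hypothesis alpha_ge0 : 0 <= alpha.
Hypothesis soup : is_loop_soup alpha N.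

Lemma loop_measure_ge0 (g : unrooted_loop P) : 0 <= loop_measure g.
Proof. by rewrite /loop_measure mulr_ge0 ?invr_ge0// prodr_ge0. Qed.

Definition partial_occupation n w x : nat :=
  (\sum_(g <- loops_upto P n) N g w * visits g x)%N.

Lemma partial_occupation_ord n w x :
  partial_occupation n w x = (\sum_i N (nth_loop (n := n) i) w * visits (nth_loop i) x)%N.
Proof. by rewrite /partial_occupation big_tnth. Qed.

Lemma nth_loop_inj n : injective (@nth_loop R V P n).
Proof. by apply/tuple_uniqP; rewrite /= undup_uniq. Qed.

Lemma measurable_count g (A : set nat) : measurable (N g @^-1` A).
Proof. exact: measurable_funPTI. Qed.

Definition config_event n (c : 'I_(size (loops_upto P n)) -> nat) : set Omega :=
  [set w | forall i, N (nth_loop i) w = c i].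

(** The form to which mutual independence applies. *)
Lemma config_event_bigcap n (c : 'I_(size (loops_upto P n)) -> nat) :
  config_event c = \bigcap_(g in [set` loops_upto P n])
    N g @^-1` [set k | forall i, nth_loop i = g -> k = c i].
Proof.
apply/seteqP; split => w /= h.
  by move=> g _ i <-.
by move=> i; apply: (h (nth_loop i)) => //=; exact: mem_tnth.
Qed.

Lemma measurable_config_event n (c : 'I_(size (loops_upto P n)) -> nat) :
  measurable (config_event c).
Proof.
rewrite config_event_bigcap; apply: fin_bigcap_measurable => // g _.
exact: measurable_count.
Qed.

Lemma prob_config_event n (c : 'I_(size (loops_upto P n)) -> nat) :
  Pr (config_event c) = (\prod_i ((alpha * loop_measure (nth_loop i)) ^+ c i / (c i)`!%:R *
      expR (- (alpha * loop_measure (nth_loop i)))))%:E.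
Proof.
rewrite config_event_bigcap (soup.1 (loops_upto P n) _ (undup_uniq _)) [LHS]big_tnth.
rewrite -prodEFin; apply: eq_bigr => i _.
have r0 : 0 <= alpha * loop_measure (nth_loop i).
  by rewrite mulr_ge0// loop_measure_ge0.
rewrite -/(nth_loop i) -poisson_prob_set1//.
rewrite -(soup.2 (nth_loop i)) /distribution /pushforward; congr (Pr _).
apply/seteqP; split => w /= h; first exact: h.
by move=> j /nth_loop_inj ->.
Qed.

Definition configs n (q : V -> nat) : seq {ffun 'I_(size (loops_upto P n)) -> 'I_n.+1} :=
  [seq c <- enum {ffun 'I_(size (loops_upto P n)) -> 'I_n.+1}
    | hits (fun i => visits (nth_loop i)) q c].

(** On this event no loop occurs more than |q| times, since every loop has at
    least one point. *)
Lemma partial_occupation_bigcup n q : (mass q <= n)%N ->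
  [set w | partial_occupation n w = q] =
  \bigcup_(c in [set` configs n q]) config_event (fun i => c i).
Proof.
move=> qn; apply/seteqP; split => [w /= wq|w [c /=]]; last first.
  rewrite mem_filter => /andP[/hitsP <- _] wc; apply/funext => x.
  by rewrite partial_occupation_ord; apply: eq_bigr => i _; rewrite wc.
have wn (i : 'I_(size (loops_upto P n))) : (N (nth_loop i) w < n.+1)%N.
  rewrite ltnS (leq_trans _ qn)// -wq /mass.
  under eq_bigr do rewrite partial_occupation_ord.
  rewrite exchange_big /= (bigD1 i)//= (leq_trans _ (leq_addr _ _))//.
  by rewrite -big_distrr /= leq_pmulr// -/(mass (visits (nth_loop i))) mass_visits size_rooted.
exists [ffun i => Ordinal (wn i)]; last by move=> i; rewrite ffunE.
rewrite /= mem_filter mem_enum andbT; apply/hitsP; rewrite -wq; apply/funext => x.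
by rewrite partial_occupation_ord; apply: eq_bigr => i _; rewrite ffunE.
Qed.

Lemma measurable_partial_occupation n q : (mass q <= n)%N ->
  measurable [set w | partial_occupation n w = q].
Proof.
move=> qn; rewrite partial_occupation_bigcup//.
by apply: fin_bigcup_measurable => // c _; exact: measurable_config_event.
Qed.

Lemma prob_partial_occupation n q : (mass q <= n)%N ->
  Pr [set w | partial_occupation n w = q] =
  (expR (- (alpha * loop_mass P n)) * per_coef P alpha q)%:E.
Proof.
move=> qn; rewrite -(@loop_coefE _ _ _ _ n)// partial_occupation_bigcup//.
pose rate (i : 'I_(size (loops_upto P n))) := alpha * loop_measure (nth_loop i).
rewrite measure_fin_bigcup//; last 2 first.
- move=> c c' _ _ [w [wc wc']]; apply/ffunP => i; apply: val_inj.
  by rewrite /= -wc wc'.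
- by move=> c _; exact: measurable_config_event.
have confU : uniq (configs n q) by exact/filter_uniq/enum_uniq.
rewrite -fsbig_seq// /configs big_filter big_enum_cond /=.
under eq_bigr => c _.
  rewrite prob_config_event (_ : \prod_i _ =
    expR (- (alpha * loop_mass P n)) * conf_weight rate c); last first.
    rewrite big_split /= mulrC; congr (_ * _).
    rewrite -expR_sum sumrN -mulr_sumr -sum_loop_measure_mass.
    by rewrite [in RHS]big_tnth.
  over.
by rewrite sumEFin -mulr_sumr.
Qed.

(** A loop longer than |q| has more than |q| visits in total, so it cannot
    occur. *)
Lemma count_visits_le w q g : (forall x, N g w * visits g x <= q x)%N ->
  (mass q < size (val (repr g)))%N -> N g w = 0%N.
Proof.
move=> h; rewrite ltnNge; case: (posnP (N g w)) => // Ng /negP[].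
rewrite -mass_visits (leq_trans (leq_pmull _ Ng))// /mass big_distrr /=.
by apply: leq_sum => x _; exact: h.
Qed.

Lemma count_partial_le n w g x : g \in loops_upto P n ->
  (N g w * visits g x <= partial_occupation n w x)%N.
Proof.
move=> gn; rewrite /partial_occupation (big_rem g)//=; exact: leq_addr.
Qed.

Lemma count_occupation_le w g x :
  (((N g w * visits g x)%N%:R : R)%:E <= occupation N x w)%E.
Proof.
rewrite /occupation (esumID [set g]); last by move=> h _; rewrite lee_fin.
rewrite setTI esum_set1 ?lee_fin//.
by rewrite leeDl// esum_ge0// => h _; rewrite lee_fin.
Qed.

Lemma occupation_partial n w x :
  (forall g, g \notin loops_upto P n -> N g w = 0%N) ->
  occupation N x w = ((partial_occupation n w x)%:R)%:E.
Proof.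
move=> h; rewrite /occupation (esumID [set` loops_upto P n]); last by move=> g _; rewrite lee_fin.
rewrite !setTI [X in (_ + X)%E]esum1 ?adde0; last first.
  by move=> g /= /negP gn; rewrite h ?mul0n.
rewrite esum_fset; [|exact: finite_seq|by move=> g _; rewrite lee_fin].
by rewrite -fsbig_seq ?undup_uniq// sumEFin -natr_sum.
Qed.

Lemma partial_occupation_stable n m w x : (n <= m)%N ->
  (forall g, g \in loops_upto P m -> g \notin loops_upto P n -> N g w = 0%N) ->
  partial_occupation m w x = partial_occupation n w x.
Proof.
move=> nm h; rewrite /partial_occupation (bigID (mem (loops_upto P n))) /=.
rewrite [X in (_ + X)%N]big1_seq ?addn0 => [|g /andP[gn gm]]; last by rewrite h ?mul0n.
rewrite -big_filter; apply/perm_big/uniq_perm; rewrite ?filter_uniq ?undup_uniq//.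
move=> g; rewrite mem_filter !mem_loops_upto; apply/andb_idr => gn.
exact: leq_trans gn nm.
Qed.

Definition occupation_event (q : V -> nat) : set Omega :=
  [set w | forall x, occupation N x w = ((q x)%:R)%:E].

Lemma partial_occupation_nonincreasing q n m : (mass q <= n)%N -> (n <= m)%N ->
  [set w | partial_occupation m w = q] `<=` [set w | partial_occupation n w = q].
Proof.
move=> qn nm w /= wq; rewrite -[RHS]wq; apply/esym/funext => x.
apply: partial_occupation_stable => // g gm; rewrite mem_loops_upto -ltnNge => gn.
apply: (@count_visits_le w q); last exact: leq_ltn_trans gn.
by move=> y; rewrite -wq; exact: count_partial_le.
Qed.

(** On either side no loop longer than |q| occurs; on the right this holds for
    a given loop because the term whose index is its length counts it. *)
Lemma occupation_eventE q :
  occupation_event q = \bigcap_k [set w | partial_occupation (k + mass q) w = q].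
Proof.
apply/seteqP; split => w /= h.
  move=> k _ /=; apply/funext => x; apply/eqP; rewrite -(eqr_nat R); apply/eqP/EFin_inj.
  rewrite -h -occupation_partial// => g; rewrite mem_loops_upto -ltnNge => gn.
  apply: (@count_visits_le w q); last exact: leq_ltn_trans (leq_addl _ _) gn.
  by move=> y; rewrite -(ler_nat R) -lee_fin -h count_occupation_le.
move=> x; rewrite (@occupation_partial (mass q)); first by rewrite (h 0%N I).
move=> g; rewrite mem_loops_upto -ltnNge => gn.
apply: (@count_visits_le w q) => // y.
rewrite -[in X in (_ <= X)%N](h (size (val (repr g))) I); apply: count_partial_le.
by rewrite mem_loops_upto leq_addr.
Qed.

End PartialOccupation.

Theorem theorem1p2 (R : realType) (V : finType) (P : V -> V -> R) (alpha : R)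
  (d : measure_display) (Omega : measurableType d) (Pr : probability Omega R)
  (N : unrooted_loop P -> {RV Pr >-> nat})
  (V_nonempty : (0 < #|V|)%N)
  (P_sub_markovian : sub_markovian P)
  (P_transient : transient P)
  (alpha_gt0 : 0 < alpha)
  (N_loop_soup : is_loop_soup alpha N)
  (q : V -> nat) :
  Pr [set w | forall x : V, occupation N x w = ((q x)%:R)%:E] =
  ((\det (1%:M - mx_of P)) `^ alpha *
    (alpha_per alpha (repeat_mx P (q := q)) / (\prod_(x : V) (q x)`!)%N%:R))%:E.
Proof.
have [P0 _] := P_sub_markovian.
rewrite alpha_per_repeat -/(occupation_event N q).
(* The shift by |q| puts every index in the range where the events decrease
   and the formula for their probability holds. *)
pose F k := [set w | partial_occupation N (k + mass q) w = q].
have mF k : measurable (F k) by apply: measurable_partial_occupation; exact: leq_addl.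
have Fcvg : (Pr \o F) k @[k --> \oo] --> Pr (occupation_event N q).
  rewrite occupation_eventE; apply: nonincreasing_cvg_mu => //.
  - by rewrite (le_lt_trans (probability_le1 _ _)) ?ltry.
  - by apply: bigcapT_measurable.
  - move=> m n mn; apply/subsetPset/partial_occupation_nonincreasing.
      exact: leq_addl.
    by rewrite leq_add2r.
have Fprob : (Pr \o F) k @[k --> \oo] -->
    ((\det (1%:M - mx_of P)) `^ alpha * per_coef P alpha q)%:E.
  rewrite (_ : Pr \o F = fun k =>
    (expR (- (alpha * loop_mass P (k + mass q))) * per_coef P alpha q)%:E); last first.
    apply/funext => k; apply: (prob_partial_occupation P0 (ltW alpha_gt0) N_loop_soup).
    exact: leq_addl.
  apply: cvg_EFin; first exact: nearW.
  apply: cvgM; last exact: cvg_cst.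
  rewrite (cvg_shiftn (mass q) (fun k => expR (- (alpha * loop_mass P k)))).
  exact: expR_loop_mass_cvg.
exact: cvg_unique Fcvg Fprob.
Qed.
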